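(* Let $g$ be a non-negative real-valued multiplicative function such that: (a) $g$ is uniformly bounded on the primes, i.e. $g(p)\le \beta$ for some constant $\beta$ and all primes $p$; (b) the series $\sum q^{-1} g(q)$, taken over the prime-powers $q=p^k$ with $k\ge 2$, converges; (c) the sums $y^{-1}\sum_{q\le y} g(q)\log q$, where $q$ runs over all prime-powers, are uniformly bounded for $y\ge 2$. Let $h$ be a complex-valued multiplicative function satisfying $|h(n)|\le g(n)$ for all $n\ge1$. Set $G(x)=\sum_{n\le x} n^{-1}g(n)$ and $H(x)=\sum_{n\le x} n^{-1}h(n)$ for $x\ge 1$. Then, as $x\to\infty$, \[ H(x) = \left( \prod_{p\le x} \left(1+\frac{h(p)}{p}+\frac{h(p^2)}{p^2}+\cdots\right)\left(1+\frac{g(p)}{p}+\frac{g(p^2)}{p^2}+\cdots\right)^{-1} + o(1)\right) G(x). \]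
   Context: Multiplicative means $f(mn)=f(m)f(n)$ whenever $\gcd(m,n)=1$, with $f(1)=1$. The product is over primes $p\le x$. *)

(* Defs.v *)
From HB Require Import structures.
From mathcomp Require Import all_boot all_order all_algebra.
From mathcomp Require Import all_classical all_reals all_analysis.
From mathcomp Require Import complex.
Set Implicit Arguments. Unset Strict Implicit. Unset Printing Implicit Defensive.
Import Order.TTheory GRing.Theory Num.Theory numFieldTopology.Exports numFieldNormedType.Exports.
Local Open Scope ring_scope.

Definition arith_multiplicative (S : pzSemiRingType) (f : nat -> S) : Prop :=
  f 1%N = 1 /\ forall m n : nat, coprime m n -> f (m * n)%N = f m * f n.

Definition prime_power (q : nat) : Prop :=
  exists p k : nat, prime p /\ (1 <= k)%N /\ q = (p ^ k)%N.

Definition higher_prime_power (q : nat) : Prop :=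
  exists p k : nat, prime p /\ (2 <= k)%N /\ q = (p ^ k)%N.

Definition sum_upto (R : realType) (V : nmodType) (x : R) (F : nat -> V) : V :=
  \sum_(1 <= n < (Num.truncn x).+1) F n.

Definition euler_factor (R : realType) (f : nat -> R[i]) (p : nat) : R[i] :=
  limn (fun N : nat => (\sum_(k < N) f (p ^ k)%N / ((p ^ k)%N)%:R : (R[i])^o)).

(* Main.v *)
(** With [w n = g n / n] and [v n = h n / n], cut the primes [p <= N] at [y = N^(1/m)] and write
    every [n <= N] as [a * b], where [a] has only prime factors [<= y] and [b] only prime factors
    in [(y, N]].  Replacing the sum over [a <= N / b] by the complete Euler product over [p <= y]
    costs at most the sum of [w a * w b] over [b <= N < a * b].  Condition (c) gives
    [(ln u) * sum_(u < n <= x) w n <= C * (2 + ln (x / u)) * G x] (write [ln n] as the sum of [ln q]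
    over the prime powers [q] exactly dividing [n]); together with a first moment bound for the
    tail of the [y]-smooth sum this makes the cost [o(G N)] as [m] grows.

    Put [t = sum_p (w p - Re (v p))].  If [t] diverges, the ratio of Euler products over [p <= y]
    tends to [0], hence so do [H / G] and the full product.  If [t] converges, then since
    [|w p - v p|^2 <= 2 * w p * (w p - Re (v p))] the sums of [v b] and [w b] over the rough part
    are asymptotically equal for fixed [m], and so are the corresponding Euler products.

    Euler factors are truncated at an exponent [K >= N], so that every smooth or rough sum is a
    finite sum over the divisors of [prod_p p ^ K], and [K] tends to infinity last. *)

Require Import Defs.
From HB Require Import structures.
From mathcomp Require Import all_boot all_order all_algebra.
From mathcomp Require Import all_classical all_reals all_analysis.
From mathcomp Require Import complex.
From mathcomp Require Import zify ring lra.
Import Order.TTheory GRing.Theory Num.Theory numFieldTopology.Exports numFieldNormedType.Exports.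
Local Open Scope ring_scope.
Local Open Scope complex_scope.
Local Open Scope classical_set_scope.

(** * Divisor sums and exact prime power divisors *)

(** The image of an injection consists of distinct indices, and the remaining terms are nonnegative.
    Mostly used with [f] the identity, to enlarge a range of summation. *)
Lemma ler_sum_inj (R : numDomainType) (I J : eqType) (s : seq I) (t : seq J)
    (P : pred I) (Q : pred J) (f : I -> J) (F : J -> R) :
  uniq s -> {in [pred i | (i \in s) && P i] &, injective f} ->
  (forall i, i \in s -> P i -> f i \in t /\ Q (f i)) ->
  (forall j, j \in t -> Q j -> 0 <= F j) ->
  \sum_(i <- s | P i) F (f i) <= \sum_(j <- t | Q j) F j.
Proof.
move=> us inj_f sub_f F0.
rewrite -big_filter -(big_map f predT F) -[leRHS]big_filter.
have uf : uniq (map f [seq i <- s | P i]).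
  rewrite map_inj_in_uniq ?filter_uniq // => i j.
  by rewrite !mem_filter => /andP[Pi si] /andP[Pj sj]; apply: inj_f; rewrite inE ?si ?sj.
have sub : {subset map f [seq i <- s | P i] <= [seq j <- t | Q j]}.
  move=> _ /mapP[i + ->]; rewrite mem_filter => /andP[Pi si].
  by have [tf Qf] := sub_f i si Pi; rewrite mem_filter tf Qf.
have {}F0 : forall j, j \in [seq j <- t | Q j] -> 0 <= F j.
  by move=> j; rewrite mem_filter => /andP[Qj tj]; apply: F0.
move: (map f _) [seq j <- t | Q j] uf sub F0 => {f s us inj_f sub_f t} s t.
elim: s t => [|x s IHs] t /= us sub F0.
  by rewrite big_nil big_seq; apply: sumr_ge0.
have xt : x \in t by apply: sub; rewrite mem_head.
case/andP: us => xs us.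
rewrite (perm_big _ (perm_to_rem xt)) /= !big_cons lerD2l; apply: IHs => //.
  move=> z zs; apply: rem_mem; first by apply: contraNneq xs => <-.
  by apply: sub; rewrite inE zs orbT.
by move=> j /mem_rem; apply: F0.
Qed.

(** The inverse of [(a, b) |-> a * b] is [d |-> (gcdn d A, gcdn d B)]. *)
Lemma divisors_coprimeM A B : (0 < A)%N -> (0 < B)%N -> coprime A B ->
  perm_eq (divisors (A * B)) [seq (a * b)%N | a <- divisors A, b <- divisors B].
Proof.
move=> A0 B0 coAB; have AB0 : (0 < A * B)%N by rewrite muln_gt0 A0.
have gcdAE a b : (a %| A)%N -> (b %| B)%N -> gcdn (a * b) A = a.
  move=> aA bB; rewrite gcdnC Gauss_gcdl; first exact/gcdn_idPr.
  exact: coprime_dvdr bB coAB.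
have gcdBE a b : (a %| A)%N -> (b %| B)%N -> gcdn (a * b) B = b.
  move=> aA bB; rewrite gcdnC Gauss_gcdr; first exact/gcdn_idPr.
  by rewrite coprime_sym; exact: coprime_dvdl aA coAB.
apply: uniq_perm; first exact: divisors_uniq.
  apply: allpairs_uniq; rewrite ?divisors_uniq // => -[a b] [c d].
  move=> /allpairsP[[a1 b1] [/= + + [-> ->]]] /allpairsP[[c1 d1] [/= + + [-> ->]]].
  rewrite -!dvdn_divisors // => aA bB cA dB abcd.
  have ac : a1 = c1 by rewrite -[LHS](gcdAE _ _ aA bB) -[RHS](gcdAE _ _ cA dB) abcd.
  have bd : b1 = d1 by rewrite -[LHS](gcdBE _ _ aA bB) -[RHS](gcdBE _ _ cA dB) abcd.
  by rewrite ac bd.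
move=> d; rewrite -dvdn_divisors //; apply/idP/allpairsP => /= [dAB|].
  exists (gcdn d A, gcdn d B); rewrite /= -!dvdn_divisors // !dvdn_gcdr.
  split=> //; apply/eqP; rewrite eqn_dvd; apply/andP; split; last first.
    rewrite Gauss_dvd ?dvdn_gcdl //.
    by apply: coprime_dvdl (dvdn_gcdr _ _) _; apply: coprime_dvdr (dvdn_gcdr _ _) _.
  rewrite muln_gcdl !muln_gcdr !dvdn_gcd dAB.
  by rewrite (dvdn_mulr d (dvdnn d)) (dvdn_mulr B (dvdnn d)) (dvdn_mull A (dvdnn d)).
by move=> [[a b] /= []]; rewrite -!dvdn_divisors // => aA bB ->; apply: dvdn_mul.
Qed.

Lemma big_divisors_coprimeM (V : nmodType) A B (F : nat -> V) :
  (0 < A)%N -> (0 < B)%N -> coprime A B ->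
  \sum_(d <- divisors (A * B)) F d =
  \sum_(a <- divisors A) \sum_(b <- divisors B) F (a * b)%N.
Proof.
move=> A0 B0 coAB; rewrite (perm_big _ (divisors_coprimeM _ _ A0 B0 coAB)).
exact: big_allpairs_dep.
Qed.

Lemma big_divisors_pfactor (V : nmodType) p K (F : nat -> V) : prime p ->
  \sum_(d <- divisors (p ^ K)) F d = \sum_(k < K.+1) F (p ^ k)%N.
Proof.
move=> pp; have pK0 : (0 < p ^ K)%N by rewrite expn_gt0 prime_gt0.
have -> : \sum_(k < K.+1) F (p ^ k)%N = \sum_(d <- [seq (p ^ k)%N | k <- iota 0 K.+1]) F d.
  by rewrite big_map -(big_mkord predT (fun k => F (p ^ k)%N)) /index_iota subn0.
apply: perm_big; apply: uniq_perm; first exact: divisors_uniq.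
  rewrite map_inj_uniq ?iota_uniq // => i j; exact: (expnI (prime_gt1 pp)).
move=> d; rewrite -dvdn_divisors //; apply/(dvdn_pfactor _ _ pp)/mapP => -[k kK ->].
  by exists k; rewrite // mem_iota add0n ltnS.
by exists k => //; move: kK; rewrite mem_iota add0n ltnS.
Qed.

(** Reads [p] off from the [p]-part of [n], as the injectivity argument of [sum_parts_le]
    requires. *)
Lemma primes_partE n p : p \in primes n -> pdiv (n`_p)%N = p.
Proof.
move=> pn; have := pn; rewrite p_part -logn_gt0; case: (logn p n) => // k _.
by rewrite pdiv_pfactor //; move: pn; rewrite mem_primes => /andP[].
Qed.

Lemma prime_power_part n p : p \in primes n -> prime_power (n`_p)%N.
Proof.
move=> pn; have : prime p by move: pn; rewrite mem_primes => /andP[].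
by exists p, (logn p n); rewrite p_part logn_gt0 pn.
Qed.

Lemma ln_sum_parts (R : realType) n : (0 < n)%N ->
  ln (n%:R : R) = \sum_(p <- primes n) ln ((n`_p)%N%:R : R).
Proof.
move=> n0; rewrite {1}(prod_prime_decomp n0) prime_decompE big_map /=.
under [RHS]eq_bigr do rewrite p_part.
have: all prime (primes n) by exact: all_prime_primes.
elim: (primes n) => [|p s IHs] /=; first by rewrite !big_nil ln1.
case/andP=> pp ps; rewrite !big_cons natrM lnM ?IHs // posrE ltr0n.
  by rewrite expn_gt0 prime_gt0.
rewrite big_seq; elim/big_ind: _ => [//|a b|q qs]; first by rewrite muln_gt0 => -> ->.
by rewrite expn_gt0 prime_gt0 //; apply: (allP ps).
Qed.

(* Each pair [(n, p)] is recovered from the coprime factorisation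
   [n = n`_p * n`_p^']. *)
Lemma sum_parts_le (R : numDomainType) (s s1 s2 : seq nat) (F : nat -> nat -> R) :
  uniq s -> {in s, forall n, 0 < n}%N ->
  (forall n p, n \in s -> p \in primes n -> n`_p^' \in s1 /\ n`_p \in s2)%N ->
  (forall m q, 0 <= F m q) ->
  \sum_(n <- s) \sum_(p <- primes n) F (n`_p^')%N (n`_p)%N <=
  \sum_(m <- s1) \sum_(q <- s2 | `[< prime_power q >] && ((m * q)%N \in s)) F m q.
Proof.
move=> us s0 s12 F0.
rewrite -(big_allpairs_dep (h := fun n p : nat => (n, p)) (r1 := s) (r2 := primes)
  (F := fun x => F (x.1`_x.2^')%N (x.1`_x.2)%N)).
under [leRHS]eq_bigr do rewrite big_mkcond /=.
rewrite -(big_allpairs_dep (h := fun n p : nat => (n, p)) (r1 := s1) (r2 := fun=> s2)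
  (F := fun x => if `[< prime_power x.2 >] && ((x.1 * x.2)%N \in s) then F x.1 x.2 else 0)).
rewrite -big_mkcond /=.
pose f (x : nat * nat) := (x.1`_x.2^', x.1`_x.2)%N.
apply: (@ler_sum_inj R _ _ _ _ predT (fun x => `[< prime_power x.2 >] && ((x.1 * x.2)%N \in s))
  f (fun x => F x.1 x.2)).
- apply: allpairs_uniq_dep => // [n _|]; first exact: primes_uniq.
  by move=> [? ?] [? ?] _ _ [-> ->].
- move=> [n p] [m q]; rewrite !inE /= !andbT => /allpairsPdep[n1 [p1 [n1s p1n [-> ->]]]].
  move=> /allpairsPdep[m1 [q1 [m1s q1m [-> ->]]]] [e1 e2].
  by rewrite -(primes_partE _ _ p1n) -(primes_partE _ _ q1m) e2 -(partnC p1 (s0 _ n1s)) e1 e2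
    partnC ?s0.
- move=> _ /allpairsPdep[n [p [ns pn ->]]] _ /=.
  have [ns1 ns2] := s12 _ _ ns pn; split.
    by apply/allpairsPdep; exists (n`_p^')%N, (n`_p)%N.
  rewrite mulnC partnC ?s0 // ns andbT; apply/asboolP.
  exact: prime_power_part pn.
- by move=> *; apply: F0.
Qed.

(** * Consequences of the prime power condition *)

Lemma ln_nat_ge0 (R : realType) n : 0 <= ln (n%:R : R).
Proof. by case: n => [|n]; [rewrite ln0 | rewrite ln_ge0 // ler1n]. Qed.

Lemma prime_power_gt1 q : prime_power q -> (1 < q)%N.
Proof.
move=> [p [k [pp [k0 ->]]]]; case: k k0 => // k _; rewrite expnS.
by rewrite (leq_trans (prime_gt1 pp)) // leq_pmulr // expn_gt0 prime_gt0.
Qed.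

Lemma prime_power_prime p : prime p -> prime_power p.
Proof. by move=> pp; exists p, 1%N; rewrite expn1. Qed.

Section LogarithmicMeans.
Variables (R : realType) (w : nat -> R) (C : R).
(** The last hypothesis is condition (c) for the weights [w n = g n / n], in the form that partial
    summation delivers in [sum_div_le_ln]. *)
Hypotheses (w_ge0 : forall n, 0 <= w n)
  (wM : forall m n, coprime m n -> w (m * n)%N = w m * w n)
  (C_ge0 : 0 <= C)
  (sum_prime_powers : forall u n, (0 < u <= n)%N ->
    \sum_(u.+1 <= q < n.+1 | `[< prime_power q >]) w q * ln (q%:R : R)
      <= C * (1 + ln (n%:R : R) - ln (u%:R : R))).

Let wE n (p : nat) : (0 < n)%N -> w n = w (n`_p^')%N * w (n`_p)%N.
Proof. by move=> n0; rewrite -wM ?[(_ * n`_p)%N]mulnC ?partnC // coprime_sym coprime_partC. Qed.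

Let part_bounds n (p : nat) : (0 < n)%N -> ((n`_p^')%N \in divisors n) && ((n`_p)%N \in divisors n).
Proof. by move=> n0; rewrite -!dvdn_divisors // !dvdn_part. Qed.

(** For [n > u], [ln u] is at most [ln n], the sum of the logarithms of the exact prime power
    divisors [q] of [n]. Writing [n = m * q] with [m] fixed leaves [q] in the window from [u / m] to
    [N / m], whose logarithmic length is again [ln (N / u)] up to rounding; the rounding turns the
    [1] of the hypothesis into [2]. *)
Lemma log_window u N : (0 < u <= N)%N ->
  ln (u%:R : R) * \sum_(u.+1 <= n < N.+1) w n <=
  C * (2 + ln (N%:R : R) - ln (u%:R : R)) * \sum_(1 <= n < N.+1) w n.
Proof.
move=> /andP[u0 uN].
pose F m q : R := w m * (w q * ln q%:R).
have F0 m q : 0 <= F m q by rewrite !mulr_ge0 ?ln_nat_ge0.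
apply: (@le_trans _ _ (\sum_(u.+1 <= n < N.+1) \sum_(p <- primes n) F (n`_p^')%N (n`_p)%N)).
  rewrite mulr_sumr; apply: ler_sum_nat => n /andP[un _].
  have n0 : (0 < n)%N by apply: leq_trans un.
  have -> : \sum_(p <- primes n) F (n`_p^')%N (n`_p)%N = w n * ln n%:R.
    rewrite (ln_sum_parts R n) // mulr_sumr; apply: eq_bigr => p _.
    by rewrite /F mulrA -wE.
  rewrite mulrC ler_wpM2l // ler_ln ?posrE ?ltr0n // ler_nat; exact: ltnW.
apply: le_trans (@sum_parts_le R _ (index_iota 1 N.+1) (index_iota 1 N.+1) F _ _ _ F0) _.
- exact: iota_uniq.
- by move=> n; rewrite mem_index_iota => /andP[un _]; apply: leq_trans un.
- move=> n p; rewrite mem_index_iota => /andP[un nN] _.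
  have n0 : (0 < n)%N by apply: leq_trans un.
  have /andP[] := part_bounds n p n0; rewrite -!dvdn_divisors // => d1 d2.
  rewrite !mem_index_iota !ltnS (leq_trans (dvdn_leq n0 d1)) // (leq_trans (dvdn_leq n0 d2)) //.
  by rewrite (dvdn_gt0 n0 d1) (dvdn_gt0 n0 d2).
rewrite mulrC mulr_suml big_nat [leRHS]big_nat; apply: ler_sum => m /andP[m0 mN].
rewrite -mulr_sumr ler_wpM2l //.
(* The maximum with [1] keeps the window admissible and loses no term, since prime powers exceed
   [1]. *)
pose u' := maxn 1 (u %/ m); pose N' := (N %/ m)%N.
have u'N' : (0 < u' <= N')%N.
  by rewrite leq_maxl geq_max divn_gt0 // -ltnS mN leq_div2r.
apply: (@le_trans _ _ (\sum_(u'.+1 <= q < N'.+1 | `[< prime_power q >]) w q * ln (q%:R : R))).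
  apply: (@ler_sum_inj R nat nat _ _ _ _ id (fun q => w q * ln (q%:R : R))).
  - exact: iota_uniq.
  - by move=> ? ?.
  - move=> q _ /andP[qq]; rewrite !mem_index_iota => /andP[umq mqN]; split=> //.
    have q1 := prime_power_gt1 _ (asboolW qq).
    apply/andP; split; last by rewrite ltnS leq_divRL // mulnC.
    by rewrite gtn_max q1 /= ltn_divLR // mulnC.
  - by move=> q _ _; rewrite mulr_ge0 ?ln_nat_ge0.
apply: le_trans (sum_prime_powers _ _ u'N') _; rewrite ler_wpM2l //.
have [u'0 le'] := andP u'N'.
suff : ln (N'%:R : R) + ln (u%:R : R) <= 1 + ln (N%:R : R) + ln (u'%:R : R) by lra.
have N'0 : (0 < N')%N by apply: leq_trans le'.
have N0 : (0 < N)%N by apply: leq_trans uN.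
have ln2 : ln (2 : R) <= 1 by have := @le_ln1Dx R 1; rewrite -[2]/(1 + 1); apply; lra.
suff : ln (N'%:R : R) + ln (u%:R : R) <= ln 2 + ln (N%:R : R) + ln (u'%:R : R) by lra.
rewrite -!lnM ?posrE ?mulr_gt0 ?ltr0n // ler_ln ?posrE ?mulr_gt0 ?ltr0n //.
rewrite -!natrM ler_nat.
have h1 : (N' * m <= N)%N by apply: leq_trunc_div.
(* Rounding down costs at most a factor [2], because [u %/ m + 1 <= 2 * u']. *)
have h2 : (u <= 2 * u' * m)%N.
  apply: ltnW; rewrite -ltn_divLR // /u'; lia.
have : (N' * u <= N' * (2 * u' * m))%N by rewrite leq_mul2l h2 orbT.
move=> /leq_trans; apply.
have -> : (N' * (2 * u' * m) = (N' * m) * (2 * u'))%N by ring.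
have -> : (2 * N * u' = N * (2 * u'))%N by ring.
by rewrite leq_mul2r h1 orbT.
Qed.

(** A Markov-type bound: each [a > T] either has an exact prime power divisor above [y], or has all
    of them at most [y] with logarithms adding up to [ln a > ln T]. In both cases the weights [phi]
    of these divisors sum to at least [1]. A prime power above [y] dividing [A] has exponent at
    least [2], since the primes of [A] are at most [y]. *)
Lemma smooth_tail y T A : (0 < A)%N -> (0 < y)%N -> (1 < T)%N ->
  (forall p, prime p -> p %| A -> p <= y)%N ->
  \sum_(a <- divisors A | (T < a)%N) w a <=
  (\sum_(y.+1 <= q < A.+1 | `[< higher_prime_power q >]) w q
    + C * (1 + ln (y%:R : R)) / ln (T%:R : R)) * \sum_(a <- divisors A) w a.
Proof.
move=> A0 y0 T1 Ay.
have lnT : 0 < ln (T%:R : R) by rewrite ln_gt0 // ltr1n.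
pose phi q : R := if (q <= y)%N then ln q%:R / ln T%:R else 1.
have phi0 q : 0 <= phi q.
  by rewrite /phi; case: ifP => // _; rewrite divr_ge0 ?ln_nat_ge0 // ltW.
pose F m q := w m * (w q * phi q).
have F0 m q : 0 <= F m q by rewrite !mulr_ge0.
have div_gt0 a : a \in divisors A -> (0 < a)%N.
  by rewrite -dvdn_divisors //; apply: dvdn_gt0.
apply: (@le_trans _ _ (\sum_(a <- divisors A) \sum_(p <- primes a) F (a`_p^')%N (a`_p)%N)).
  rewrite big_mkcond big_seq [leRHS]big_seq; apply: ler_sum => a aA.
  have a0 := div_gt0 a aA.
  have -> : \sum_(p <- primes a) F (a`_p^')%N (a`_p)%N = w a * \sum_(p <- primes a) phi (a`_p)%N.
    by rewrite mulr_sumr; apply: eq_bigr => p _; rewrite /F mulrA -wE.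
  have s0 : 0 <= \sum_(p <- primes a) phi (a`_p)%N by apply: sumr_ge0.
  case: ifP => Ta; last by rewrite mulr_ge0.
  rewrite ler_peMr //.
  have [/hasP[p pa yp]|/hasPn small] := boolP (has (fun p : nat => y < a`_p)%N (primes a)).
    rewrite (bigD1_seq p) ?primes_uniq //= {1}/phi leqNgt yp /= lerDl.
    exact: sumr_ge0.
  rewrite (eq_big_seq (fun p : nat => ln ((a`_p)%N%:R : R) / ln T%:R)); last first.
    by move=> p pa; rewrite /phi leqNgt (small p pa).
  rewrite -mulr_suml -ln_sum_parts // ler_pdivlMr // mul1r.
  by rewrite ler_ln ?posrE ?ltr0n // ?ler_nat ltnW // ltnW.
apply: le_trans (@sum_parts_le R _ (divisors A) (divisors A) F _ _ _ F0) _.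
- exact: divisors_uniq.
- exact: div_gt0.
- move=> a p aA _; have a0 := div_gt0 a aA; move: aA; rewrite -!dvdn_divisors // => aA.
  by rewrite !(dvdn_trans (dvdn_part _ _) aA).
rewrite mulrC mulr_suml; apply: ler_sum => m _; rewrite -mulr_sumr ler_wpM2l //.
apply: (@le_trans _ _ (\sum_(q <- divisors A | `[< prime_power q >]) w q * phi q)).
  apply: (@ler_sum_inj R nat nat _ _ _ _ id (fun q => w q * phi q)) => //.
  - exact: divisors_uniq.
  - by move=> q qA /andP[].
  - by move=> q _ _; rewrite mulr_ge0.
rewrite (bigID (fun q => q <= y)%N) /= addrC lerD //.
  rewrite (eq_bigr w); last by move=> q /andP[_ /negPf yq]; rewrite /phi yq mulr1.
  apply: (@ler_sum_inj R nat nat _ _ _ _ id w) => //; first exact: divisors_uniq.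
  move=> q qA /andP[/asboolP[p [k [pp [k0 qE]]]]]; rewrite -ltnNge => yq; split.
    rewrite mem_index_iota yq /= ltnS dvdn_leq // dvdn_divisors //.
  apply/asboolP; exists p, k; split=> //; split=> //.
  case: k k0 qE => // -[_ qE|//]; move: yq; rewrite ltnNge Ay //.
    by move: pp; rewrite qE expn1.
  by rewrite dvdn_divisors.
rewrite (eq_bigr (fun q => (w q * ln q%:R) / ln T%:R)); last first.
  by move=> q /andP[_ yq]; rewrite /phi yq mulrA.
rewrite -mulr_suml ler_pM2r ?invr_gt0 //.
have /sum_prime_powers : (0 < 1 <= y)%N by [].
rewrite ln1 subr0; apply: le_trans.
apply: (@ler_sum_inj R nat nat _ _ _ _ id (fun q => w q * ln (q%:R : R))) => //.
- exact: divisors_uniq.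
- move=> q _ /andP[qq qy]; split=> //.
  by rewrite mem_index_iota ltnS qy andbT prime_power_gt1 //; apply: asboolW.
- by move=> q _ _; rewrite mulr_ge0 ?ln_nat_ge0.
Qed.

End LogarithmicMeans.

(** * Splitting into smooth and rough parts *)

Lemma divisors_le_perm M N : (0 < M)%N -> (forall n, 0 < n <= N -> n %| M)%N ->
  perm_eq [seq d <- divisors M | (d <= N)%N] (index_iota 1 N.+1).
Proof.
move=> M0 dvd; apply: uniq_perm; rewrite ?iota_uniq ?filter_uniq ?divisors_uniq // => d.
rewrite mem_filter mem_index_iota ltnS -dvdn_divisors //.
apply/andP/andP => [[dN dM]|[d0 dN]]; split=> //; first exact: dvdn_gt0 dM.
by rewrite dvd ?d0.
Qed.

(** Coprimality makes the factorisation [d = a * b] of a divisor of [A * B] unique. The pairs with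
    [a * b <= N] account for all [n <= N], and [b <= N] is automatic for them; the other pairs form
    the error term. *)
Lemma sum_smooth_rough_split (K : comNzRingType) (f : nat -> K) A B N :
  (forall m n, coprime m n -> f (m * n)%N = f m * f n) ->
  (0 < A)%N -> (0 < B)%N -> coprime A B -> (forall n, 0 < n <= N -> n %| A * B)%N ->
  (\sum_(a <- divisors A) f a) * (\sum_(b <- divisors B | (b <= N)%N) f b) =
  \sum_(1 <= n < N.+1) f n +
  \sum_(b <- divisors B | (b <= N)%N) \sum_(a <- divisors A | (N < a * b)%N) f a * f b.
Proof.
move=> fM A0 B0 coAB dvd; have AB0 : (0 < A * B)%N by rewrite muln_gt0 A0.
have -> : \sum_(1 <= n < N.+1) f n =
    \sum_(b <- divisors B | (b <= N)%N) \sum_(a <- divisors A | ~~ (N < a * b)%N) f a * f b.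
  rewrite -(perm_big _ (divisors_le_perm _ _ AB0 dvd)) big_filter big_mkcond /=.
  rewrite big_divisors_coprimeM // exchange_big /= [RHS]big_mkcond /=.
  rewrite big_seq [RHS]big_seq; apply: eq_bigr => b; rewrite -dvdn_divisors // => bB.
  case: ifP => bN; last first.
    rewrite big_seq big1 // => a; rewrite -dvdn_divisors // => aA.
    case: ifP => // abN; move: bN; rewrite (leq_trans _ abN) // leq_pmull //.
    exact: dvdn_gt0 aA.
  rewrite [RHS]big_mkcond /= big_seq [RHS]big_seq; apply: eq_bigr => a.
  rewrite -dvdn_divisors // => aA; rewrite -leqNgt; case: ifP => // _; apply: fM.
  by apply: coprime_dvdl aA _; apply: coprime_dvdr bB _.
rewrite -big_split /= mulr_sumr; apply: eq_bigr => b bN.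
by rewrite mulr_suml addrC (bigID (fun a => N < a * b)%N).
Qed.

Lemma ln_natX (R : realType) y k : (0 < y)%N ->
  ln ((y ^ k)%N%:R : R) = k%:R * ln (y%:R : R).
Proof. by move=> y0; rewrite natrX lnXn ?ltr0n // mulr_natl. Qed.

Lemma ln_ge_near (R : realType) (M : R) : exists Y : nat, forall y : nat, (Y <= y)%N ->
  M <= ln (y%:R : R).
Proof.
exists (Num.truncn (expR M)).+1 => y Yy.
have : expR M < y%:R by apply: lt_le_trans (truncnS_gt _) _; rewrite ler_nat.
by move=> /ltW lt; rewrite -ler_expR lnK // posrE (lt_le_trans (expR_gt0 M)).
Qed.

Lemma nat_ge_real (R : realType) (x : R) : exists2 k : nat, (0 < k)%N & x <= k%:R.
Proof. by exists (Num.truncn x).+1 => //; apply/ltW/truncnS_gt. Qed.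

Section SmoothRough.
Variables (R : realType) (w : nat -> R) (C : R).
Hypotheses (w_ge0 : forall n, 0 <= w n)
  (wM : forall m n, coprime m n -> w (m * n)%N = w m * w n)
  (C_gt0 : 0 < C)
  (sum_prime_powers : forall u n, (0 < u <= n)%N ->
    \sum_(u.+1 <= q < n.+1 | `[< prime_power q >]) w q * ln (q%:R : R)
      <= C * (1 + ln (n%:R : R) - ln (u%:R : R)))
  (higher_tail : forall e : R, 0 < e -> exists Y : nat, forall y N : nat, (Y <= y)%N ->
    \sum_(y.+1 <= q < N | `[< higher_prime_power q >]) w q <= e).

(** By hypothesis the [a <= T] carry at least half of the sum over [A], whence the factor [2]; for
    these [a] the distinct products [a * b] lie in [(u, N * T]]. *)
Lemma smooth_mul_rough_le A B u N T : (0 < A)%N -> (0 < B)%N -> coprime A B ->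
  \sum_(a <- divisors A | (T < a)%N) w a <= 2^-1 * \sum_(a <- divisors A) w a ->
  (\sum_(a <- divisors A) w a) * (\sum_(b <- divisors B | (u < b <= N)%N) w b) <=
  2 * \sum_(u.+1 <= n < (N * T).+1) w n.
Proof.
move=> A0 B0 coAB; rewrite (bigID (fun a => T < a)%N xpredT) /=.
set t := \sum_(a <- _ | (T < a)%N) _; set s := \sum_(a <- _ | ~~ (T < a)%N) _ => half.
have AB0 : (0 < A * B)%N by rewrite muln_gt0 A0.
apply: (@le_trans _ _ (2 * s * \sum_(b <- divisors B | (u < b <= N)%N) w b)).
  by rewrite ler_wpM2r ?sumr_ge0 //; lra.
rewrite -mulrA ler_pM2l //.
apply: (@le_trans _ _ (\sum_(d <- divisors (A * B) | (u < d <= N * T)%N) w d)).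
  rewrite [leRHS]big_mkcond /= big_divisors_coprimeM // /s mulr_suml big_mkcond /=.
  rewrite big_seq [leRHS]big_seq; apply: ler_sum => a; rewrite -dvdn_divisors // => aA.
  case: ifP => aT; last by apply: sumr_ge0 => b _; case: ifP.
  rewrite mulr_sumr big_mkcond /= big_seq [leRHS]big_seq; apply: ler_sum => b.
  rewrite -dvdn_divisors // => bB; case: ifP => [/andP[ub bN]|_]; last by case: ifP.
  rewrite -leqNgt in aT.
  rewrite (leq_trans ub) ?leq_pmull ?(dvdn_gt0 _ aA) //= mulnC leq_mul // mulnC.
  rewrite wM //; by apply: coprime_dvdl aA _; apply: coprime_dvdr bB _.
apply: (@ler_sum_inj R nat nat _ _ _ _ id w) => //; first exact: divisors_uniq.
by move=> d _; rewrite mem_index_iota ltnS.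
Qed.

(** If [a * b > N], then [a > T] or [b > N %/ T]. *)
Lemma smooth_rough_error_le A B N T : (0 < A)%N -> (0 < B)%N -> (0 < T)%N ->
  \sum_(b <- divisors B | (b <= N)%N) \sum_(a <- divisors A | (N < a * b)%N) w a * w b <=
  (\sum_(a <- divisors A | (T < a)%N) w a) * (\sum_(b <- divisors B | (b <= N)%N) w b) +
  (\sum_(a <- divisors A) w a) * (\sum_(b <- divisors B | (N %/ T < b <= N)%N) w b).
Proof.
move=> A0 B0 T0.
rewrite !mulr_sumr.
have -> : \sum_(b <- divisors B | (N %/ T < b <= N)%N) (\sum_(a <- divisors A) w a) * w b =
    \sum_(b <- divisors B | (b <= N)%N)
      if (N %/ T < b)%N then (\sum_(a <- divisors A) w a) * w b else 0.
  by rewrite -big_mkcondr /=; apply: eq_bigl => b; rewrite andbC.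
rewrite -big_split /=; apply: ler_sum => b bN; rewrite -mulr_suml.
case: ifP => [Nb|/negbT]; last first.
  rewrite -leqNgt => bNT; rewrite addr0 ler_wpM2r //.
  apply: (@ler_sum_inj R nat nat _ _ _ _ id w) => //; first exact: divisors_uniq.
  move=> a aA Nab; split=> //; rewrite ltnNge; apply/negP => aT.
  move: Nab; rewrite ltnNge (leq_trans (leq_mul aT bNT)) // mulnC; exact: leq_trunc_div.
rewrite ler_wpDl ?mulr_ge0 ?sumr_ge0 // ler_wpM2r //.
by apply: (@ler_sum_inj R nat nat _ _ _ _ id w) => //; first exact: divisors_uniq.
Qed.

(** [smooth_tail] makes the divisors of [A] beyond a power of [y] negligible, and [log_window] does
    the same for the integers within a fixed power of [y] of [N], once [ln N] is a large multiple of
    [ln y]. Neither [m] nor [Y] depends on [A] and [B], which leaves the truncation exponent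
    free. *)
Lemma smooth_rough_estimates (eta : R) : 0 < eta ->
  exists m : nat, exists Y : nat, forall y N A B : nat,
  (Y <= y)%N -> (y ^ m <= N)%N -> (0 < A)%N -> (0 < B)%N -> coprime A B ->
  (forall p, prime p -> p %| A -> p <= y)%N ->
  (\sum_(a <- divisors A) w a) * (\sum_(b <- divisors B | (b <= N)%N) w b) <=
    4 * \sum_(1 <= n < N.+1) w n /\
  \sum_(b <- divisors B | (b <= N)%N) \sum_(a <- divisors A | (N < a * b)%N) w a * w b <=
    eta * \sum_(1 <= n < N.+1) w n.
Proof.
move=> eta0; have C_ge0 := ltW C_gt0.
(* Beyond [y ^ k0] there will be at most half of the sum over [A], and beyond [y ^ k1] at most the
   proportion [eta / 8] of it. *)
have [k0 k0_gt0 k0C] := nat_ge_real R (8 * C).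
have [k1 k1_gt0 k1C] : exists2 k : nat, (0 < k)%N & 2 * C / k%:R <= eta / 16.
  have [k k_gt0 kC] := nat_ge_real R (32 * C / eta); exists k => //.
  by move: kC; rewrite ler_pdivrMr // => h; rewrite ler_pdivrMr ?ltr0n //; lra.
(* The first summand gives [GT <= 2 * G] for the sum up to [N * y ^ k0]; the second bounds the
   window from [N / y ^ k1] to [N * y ^ k0] by [eta / 4 * G]. The excess [k1 + 1] of [m] over [M]
   pays for passing from [ln N] to [ln (N %/ y ^ k1)]. *)
pose M : R := 2 * C * (2 + k0%:R) + 8 * C * (3 + k0%:R + k1%:R) / eta.
have [m k1m mM] : exists2 m : nat, (k1 < m)%N & M + k1%:R + 1 <= m%:R.
  have [k k_gt0 kM] := nat_ge_real R M; exists (k + k1 + 1)%N; first by rewrite addn1 ltnS leq_addl.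
  by rewrite !natrD !lerD2r.
have M1 : 2 * C * (2 + k0%:R) <= M.
  by rewrite lerDl divr_ge0 ?(ltW eta0) // !mulr_ge0 // !addr_ge0.
have M2 : 8 * C * (3 + k0%:R + k1%:R) / eta <= M.
  by rewrite lerDr !mulr_ge0 // !addr_ge0.
clearbody M.
have [Y1 Y1P] := ln_ge_near R 1.
(* [4^-1] serves the half bound at [k0], [eta / 16] the finer bound at [k1]. *)
have mine : 0 < Num.min (4^-1) (eta / 16) by rewrite lt_min; apply/andP; split; lra.
have [Y2 Y2P] := higher_tail _ mine.
exists m, (maxn Y1 (maxn Y2 2)) => y N A B.
rewrite !geq_max => /and3P[y1 y2 y3] ymN A0 B0 coAB Ay.
have y0 : (0 < y)%N by apply: leq_trans y3.
set L := ln (y%:R : R); have L1 : 1 <= L by apply: Y1P.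
set G := \sum_(1 <= n < N.+1) w n.
set WA := \sum_(a <- divisors A) w a.
set S := \sum_(b <- divisors B | (b <= N)%N) w b.
set E := \sum_(b <- divisors B | (b <= N)%N) _.
have WA0 : 0 <= WA by apply: sumr_ge0.
have S0 : 0 <= S by apply: sumr_ge0.
have G0 : 0 <= G by apply: sumr_ge0.
have tail k : (0 < k)%N -> \sum_(a <- divisors A | (y ^ k < a)%N) w a <=
    (Num.min (4^-1) (eta / 16) + 2 * C / k%:R) * WA.
  move=> k_gt0.
  have Tk : (1 < y ^ k)%N by rewrite -(exp1n k) ltn_exp2r.
  apply: le_trans (smooth_tail _ _ _ w_ge0 wM sum_prime_powers _ _ _ A0 y0 Tk Ay) _.
  rewrite ler_wpM2r // lerD ?Y2P // ln_natX // -/L.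
  have kL : 0 < k%:R * L by rewrite mulr_gt0 ?ltr0n //; lra.
  have kn0 : k%:R != 0 :> R by rewrite pnatr_eq0 -lt0n.
  rewrite ler_pdivrMr //; have -> : 2 * C / k%:R * (k%:R * L) = 2 * C * L by field.
  have : 0 <= C * (L - 1) by rewrite mulr_ge0 //; lra.
  lra.
have N0 : (0 < N)%N by apply: leq_trans ymN; rewrite expn_gt0 y0.
have lnN : m%:R * L <= ln (N%:R : R).
  by rewrite -ln_natX // ler_ln ?posrE ?ltr0n ?expn_gt0 ?y0 // ler_nat.
have half : \sum_(a <- divisors A | (y ^ k0 < a)%N) w a <= 2^-1 * WA.
  apply: le_trans (tail k0 _) _ => //; rewrite ler_wpM2r //.
  have h1 : Num.min (4^-1) (eta / 16) <= 4^-1 by rewrite ge_min lexx.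
  have h2 : 2 * C / k0%:R <= 4^-1 by rewrite ler_pdivrMr ?ltr0n //; lra.
  lra.
set T0 := (y ^ k0)%N in half.
have T00 : (0 < T0)%N by rewrite expn_gt0 y0.
set GT := \sum_(1 <= n < (N * T0).+1) w n.
have GT0 : 0 <= GT by apply: sumr_ge0.
have NT0 : (N <= N * T0)%N by rewrite leq_pmulr.
have lnNT : ln ((N * T0)%N%:R : R) = ln (N%:R : R) + k0%:R * L.
  by rewrite natrM lnM ?posrE ?ltr0n // ln_natX.
(* The integers in [(N, N * T0]] contribute at most half of [GT], because [ln N >= m * L] is at
   least twice [C * (2 + k0 * L)]. *)
have GTG : GT <= 2 * G.
  have N0N : (0 < N <= N * T0)%N by rewrite N0.
  have := log_window _ _ _ w_ge0 wM C_ge0 sum_prime_powers _ _ N0N.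
  have GTE : \sum_(N.+1 <= n < (N * T0).+1) w n = GT - G.
    by rewrite /GT (big_cat_nat (n := N.+1) (m := 1)) //= -/G; lra.
  rewrite lnNT GTE.
  have -> : 2 + (ln N%:R + k0%:R * L) - ln N%:R = 2 + k0%:R * L by lra.
  rewrite -/GT => h.
  have GGT : 0 <= GT - G by rewrite -GTE; apply: sumr_ge0.
  have h1 : m%:R * L * (GT - G) <= ln N%:R * (GT - G) by rewrite ler_wpM2r.
  have h2 : C * (2 + k0%:R * L) * GT <= (m%:R * L / 2) * GT.
    rewrite ler_wpM2r //.
    have : 0 <= C * 2 * (L - 1) by rewrite mulr_ge0 ?mulr_ge0 //; lra.
    have : 0 <= (m%:R - 2 * C * (2 + k0%:R)) * L.
      rewrite mulr_ge0 //; last by lra.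
      have : 0 <= k1%:R :> R by [].
      lra.
    lra.
  have h3 : m%:R * L * (GT - G) <= m%:R * L * (GT / 2) by lra.
  move: h3; rewrite ler_pM2l; first by lra.
  by rewrite mulr_gt0 // ?ltr0n ?(leq_ltn_trans _ k1m) //; lra.
have WAS : WA * S <= 4 * G.
  have := smooth_mul_rough_le _ _ 0 N _ A0 B0 coAB half.
  rewrite -/GT -/WA.
  have -> : \sum_(b <- divisors B | (0 < b <= N)%N) w b = S.
    rewrite big_mkcond /S [RHS]big_mkcond /= big_seq [RHS]big_seq.
    apply: eq_bigr => b; rewrite -dvdn_divisors // => bB.
    by rewrite (dvdn_gt0 _ bB).
  lra.
split=> //.
set T1 := (y ^ k1)%N.
have T10 : (0 < T1)%N by rewrite expn_gt0 y0.
pose u := (N %/ T1)%N.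
have u0 : (0 < u)%N.
  by rewrite divn_gt0 //; apply: leq_trans ymN; rewrite leq_pexp2l // ltnW.
apply: le_trans (smooth_rough_error_le _ _ N T1 A0 B0 T10) _.
rewrite -/WA -/S -/u.
(* [eta / 8] from the tail beyond [T1], times the [4] of [WAS]. *)
have e1 : (\sum_(a <- divisors A | (T1 < a)%N) w a) * S <= eta / 2 * G.
  have h1 : Num.min (4^-1) (eta / 16) <= eta / 16 by rewrite ge_min lexx orbT.
  apply: (@le_trans _ _ (eta / 8 * WA * S)).
    rewrite ler_wpM2r //; apply: le_trans (tail k1 _) _ => //; rewrite ler_wpM2r //.
    lra.
  have : 0 <= eta / 8 * (4 * G - WA * S) by rewrite mulr_ge0 //; lra.
  lra.
set X := \sum_(b <- divisors B | _) _.
have e2 := smooth_mul_rough_le _ _ u N _ A0 B0 coAB half.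
suff : \sum_(u.+1 <= n < (N * T0).+1) w n <= eta / 4 * G.
  by move: e2; rewrite -/WA -/X; lra.
set Z := \sum_(u.+1 <= n < (N * T0).+1) w n.
have Z0 : 0 <= Z by apply: sumr_ge0.
have uN : (0 < u <= N * T0)%N by rewrite u0 (leq_trans _ NT0) // leq_div.
have := log_window _ _ _ w_ge0 wM C_ge0 sum_prime_powers _ _ uN.
rewrite lnNT -/GT -/Z => h.
(* Here [N < (u + 1) * T1 <= 2 * u * T1], and [ln 2 <= 1]. *)
have lnu : ln (N%:R : R) <= 1 + ln (u%:R : R) + k1%:R * L.
  have ln2 : ln (2 : R) <= 1 by have := @le_ln1Dx R 1; rewrite -[2]/(1 + 1); apply; lra.
  apply: (@le_trans _ _ (ln 2 + ln (u%:R : R) + k1%:R * L)); last by lra.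
  rewrite -ln_natX // -!lnM ?posrE ?mulr_gt0 ?ltr0n // -!natrM.
  rewrite ler_ln ?posrE ?ltr0n ?muln_gt0 ?u0 // ler_nat.
  have : (N < u.+1 * T1)%N by rewrite -ltn_divLR.
  move=> /ltnW /leq_trans; apply; rewrite leq_mul2r; apply/orP; right.
  by rewrite mul2n -addnn -addn1 leq_add2l.
have k1L : 0 <= k1%:R * (L - 1) by rewrite mulr_ge0 //; lra.
have lnu' : M * L <= ln (u%:R : R).
  have : 0 <= (m%:R - k1%:R - 1 - M) * L by rewrite mulr_ge0 //; lra.
  lra.
pose D := 3 + k0%:R + k1%:R : R.
have h1 : M * L * Z <= C * (D * L) * GT.
  apply: (@le_trans _ _ (ln u%:R * Z)); first by rewrite ler_wpM2r.
  apply: le_trans h _; rewrite ler_wpM2r // ler_wpM2l // /D.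
  lra.
(* The second summand of [M] enters here; cancelling [C * D] and [8 / eta] afterwards leaves
   [Z <= eta / 4 * G]. *)
have h2 : 8 * C * D / eta * Z <= C * D * (2 * G).
  have hL : 0 < L by lra.
  rewrite -(ler_pM2l hL).
  apply: (@le_trans _ _ (M * L * Z)).
    by rewrite mulrA (mulrC L) ler_wpM2r // ler_wpM2r // ltW.
  apply: le_trans h1 _.
  have : 0 <= C * (D * L) * (2 * G - GT).
    by rewrite !mulr_ge0 // ?subr_ge0 // ?(ltW hL) // /D !addr_ge0.
  lra.
have D0 : 0 < D by rewrite /D; have : 0 <= k0%:R + k1%:R :> R; [rewrite addr_ge0 | lra].
have CD : 0 < C * D by rewrite mulr_gt0.
rewrite -(ler_pM2l CD) -(ler_pM2r (_ : 0 < 8 / eta)) ?divr_gt0 //.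
have -> : C * D * Z * (8 / eta) = 8 * C * D / eta * Z by ring.
apply: le_trans h2 _.
have -> : C * D * (eta / 4 * G) * (8 / eta) = C * D * (2 * G) by field; rewrite gt_eqF.
by [].
Qed.

End SmoothRough.

(** * Complex modulus and products over ranges of primes *)

(** The modulus with values in [R], where the order is total; the norm of [R[i]] takes its values in
    [R[i]] itself. *)
Local Notation cnorm := (@ComplexField.Normc.normc _).

Section ComplexNorm.
Variable R : realType.
Implicit Types (z t : R[i]) (s : R).

Lemma cnormE z : (cnorm z)%:C = `|z|. Proof. by []. Qed.

Lemma cnorm_ge0 z : 0 <= cnorm z.
Proof. by rewrite -lecR cnormE; exact: normr_ge0. Qed.

Lemma cnormD z t : cnorm (z + t) <= cnorm z + cnorm t.
Proof. by rewrite -lecR rmorphD /= !cnormE; exact: ler_normD. Qed.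

Lemma cnormN z : cnorm (- z) = cnorm z.
Proof. by apply: (@complexI R); rewrite !cnormE normrN. Qed.

Lemma cnormB z t : cnorm (z - t) <= cnorm z + cnorm t.
Proof. by rewrite -(cnormN t); exact: cnormD. Qed.

Lemma cnormR s : 0 <= s -> cnorm (s%:C) = s.
Proof. by move=> s0; rewrite /ComplexField.Normc.normc /= expr0n addr0 sqrtr_sqr ger0_norm. Qed.

Lemma cnorm_sum (I : Type) (r : seq I) (P : pred I) (F : I -> R[i]) :
  cnorm (\sum_(i <- r | P i) F i) <= \sum_(i <- r | P i) cnorm (F i).
Proof.
elim/big_rec2: _ => [|i x z _ le]; first by rewrite ComplexField.Normc.normc0.
by apply: le_trans (cnormD _ _) _; rewrite lerD2l.
Qed.

Lemma sqr_cnorm z : cnorm z ^+ 2 = complex.Re z ^+ 2 + complex.Im z ^+ 2.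
Proof. by case: z => a b; rewrite /= sqr_sqrtr ?addr_ge0 ?sqr_ge0. Qed.

Lemma Re_le_cnorm z : `|complex.Re z| <= cnorm z.
Proof. by rewrite -lecR cnormE; exact: normc_ge_Re. Qed.

Lemma Im_le_cnorm z : `|complex.Im z| <= cnorm z.
Proof.
rewrite -(ler_pXn2r (ltn0Sn 1)) ?nnegrE ?cnorm_ge0 // sqr_cnorm real_normK ?num_real //.
by rewrite lerDr sqr_ge0.
Qed.

(** The square of the left side is at most [2 * s * (s - Re z)]; the inequality of arithmetic and
    geometric means with a free parameter [l] linearises the root, so that the bound can be summed
    over primes. *)
Lemma cnorm_sub_real_le s z (l : R) : 0 < l -> cnorm z <= s ->
  cnorm (z - s%:C) <= l * s + (s - complex.Re z) / l.
Proof.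
move=> l0 zs.
have s0 : 0 <= s by apply: le_trans zs; exact: cnorm_ge0.
have t0 : 0 <= s - complex.Re z.
  by rewrite subr_ge0 (le_trans _ zs) // (le_trans _ (Re_le_cnorm z)) // ler_norm.
have r0 : 0 <= l * s + (s - complex.Re z) / l.
  by rewrite addr_ge0 ?mulr_ge0 ?invr_ge0 // ltW.
rewrite -(ler_pXn2r (ltn0Sn 1)) ?nnegrE ?cnorm_ge0 // sqr_cnorm.
have zs2 : cnorm z ^+ 2 <= s ^+ 2 by rewrite ler_pXn2r ?nnegrE ?cnorm_ge0.
move: zs2; rewrite sqr_cnorm; case: z {zs r0} t0 => a b /= t0 zs2.
have -> : (l * s + (s - a) / l) ^+ 2 = (l * s - (s - a) / l) ^+ 2 + 4 * s * (s - a).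
  by field; lra.
have : 0 <= (l * s - (s - a) / l) ^+ 2 by exact: sqr_ge0.
have : 0 <= s * (s - a) by rewrite mulr_ge0.
rewrite oppr0 addr0; lra.
Qed.

(** With [n = cnorm (1 + z)], one has [n ^ 2 <= (1 + s) ^ 2 - 2 * (s - Re z)]; adding
    [(1 + s - n) ^ 2 >= 0] makes this linear in [n]. *)
Lemma cnorm_add1_le s z : cnorm z <= s ->
  cnorm (1 + z) <= 1 + s - (s - complex.Re z) / (1 + s).
Proof.
move=> zs; have s0 : 0 <= s by apply: le_trans zs; exact: cnorm_ge0.
have zs2 : cnorm z ^+ 2 <= s ^+ 2 by rewrite ler_pXn2r ?nnegrE ?cnorm_ge0.
suff : (s - complex.Re z) / (1 + s) <= 1 + s - cnorm (1 + z) by lra.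
rewrite ler_pdivrMr; last by lra.
have := sqr_cnorm (1 + z); move: zs2; rewrite sqr_cnorm.
set n := cnorm (1 + z); case: z @n zs => a b n zs /= zs2.
rewrite add0r => nE; have := sqr_ge0 (1 + s - n); lra.
Qed.

End ComplexNorm.

(** * Integers with prime factors in a given range *)

(** Its divisors are the integers with all prime factors in [[m, n)] and all exponents at most [K]:
    smooth numbers for [m = 0], rough ones for [m = y.+1]. *)
Definition prime_range_prod m n K := (\prod_(m <= p < n | prime p) p ^ K)%N.

Lemma prime_range_prod_gt0 m n K : (0 < prime_range_prod m n K)%N.
Proof.
rewrite /prime_range_prod; elim/big_ind: _ => [//|a b|p pp]; first by rewrite muln_gt0 => -> ->.
by rewrite expn_gt0 prime_gt0.
Qed.

Lemma prime_dvd_range m n K p : prime p -> (p %| prime_range_prod m n K)%N -> (m <= p < n)%N.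
Proof.
move=> pp; rewrite /prime_range_prod big_nat_cond; elim/big_ind: _ => [|a b IHa IHb|q].
- by rewrite Euclid_dvd1.
- by rewrite Euclid_dvdM // => /orP[].
- case/andP=> mqn pq; rewrite Euclid_dvdX // dvdn_prime2 // => /andP[/eqP-> _].
  by [].
Qed.

Lemma coprime_prime_ranges m n k K :
  coprime (prime_range_prod m n K) (prime_range_prod n k K).
Proof.
rewrite coprime_has_primes ?prime_range_prod_gt0 //; apply/hasPn => p.
rewrite /= !mem_primes => /and3P[pp _ /(prime_dvd_range _ _ _ _ pp) /andP[np _]].
apply/negP => /and3P[_ _ /(prime_dvd_range _ _ _ _ pp) /andP[_]].
by rewrite ltnNge np.
Qed.

Lemma prime_range_prod_cat m n k K : (m <= n <= k)%N ->
  (prime_range_prod m n K * prime_range_prod n k K = prime_range_prod m k K)%N.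
Proof. by move=> /andP[mn nk]; rewrite /prime_range_prod -big_cat_nat. Qed.

(** Every exponent in the factorisation of [n] is less than [n], hence at most [K]. *)
Lemma dvd_prime_range_prod n N K : (0 < n <= N)%N -> (N <= K)%N ->
  (n %| prime_range_prod 0 N.+1 K)%N.
Proof.
move=> /andP[n0 nN] NK; apply/dvdn_partP => // p; rewrite mem_primes => /and3P[pp _ pn].
have pN : (p < N.+1)%N by rewrite ltnS (leq_trans (dvdn_leq n0 pn)).
rewrite /prime_range_prod big_mkord (bigD1 (Ordinal pN)) //= p_part dvdn_mulr //.
by rewrite dvdn_exp2l // ltnW // (leq_trans (ltn_logl _ n0)) // (leq_trans nN).
Qed.

Lemma prime_range_prodS m n K : (m <= n)%N -> prime_range_prod m n.+1 K =
  (prime_range_prod m n K * (if prime n then n ^ K else 1))%N.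
Proof. by move=> mn; rewrite /prime_range_prod big_mkcond big_nat_recr //= -big_mkcond. Qed.

Lemma coprime_prime_range_next m n K : prime n ->
  coprime (prime_range_prod m n K) (n ^ K).
Proof.
move=> pn; have := coprime_prime_ranges m n n.+1 K.
by rewrite (prime_range_prodS n n) // pn [X in coprime _ (X * _)]big_geq // mul1n.
Qed.

(** The truncated Euler product, built up by adjoining one prime at a time as a coprime factor. *)
Lemma sum_prime_range_divisors (S : comNzRingType) (f : nat -> S) m n K :
  f 1%N = 1 -> (forall a b, coprime a b -> f (a * b)%N = f a * f b) ->
  \sum_(d <- divisors (prime_range_prod m n K)) f d =
  \prod_(m <= p < n | prime p) \sum_(k < K.+1) f (p ^ k)%N.
Proof.
move=> f1 fM; have [nm|mn] := leqP n m.
  by rewrite /prime_range_prod !big_geq // big_seq1.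
elim: n mn => // n IHn; rewrite ltnS => mn.
rewrite prime_range_prodS // [RHS]big_mkcond big_nat_recr //= -big_mkcond /=.
have {}IHn : \sum_(d <- divisors (prime_range_prod m n K)) f d =
    \prod_(m <= p < n | prime p) \sum_(k < K.+1) f (p ^ k)%N.
  move: mn; rewrite leq_eqVlt => /orP[/eqP ->|//].
  by rewrite /prime_range_prod !big_geq // big_seq1.
rewrite -IHn //; case: ifP => pn; last by rewrite muln1 mulr1.
have nK : (0 < n ^ K)%N by rewrite expn_gt0 prime_gt0.
rewrite big_divisors_coprimeM ?prime_range_prod_gt0 ?coprime_prime_range_next //.
rewrite -big_divisors_pfactor // mulr_suml big_seq [RHS]big_seq; apply: eq_bigr => a.
rewrite -dvdn_divisors ?prime_range_prod_gt0 // => aA.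
rewrite mulr_sumr big_seq [RHS]big_seq; apply: eq_bigr => b; rewrite -dvdn_divisors // => bB.
rewrite fM //; apply: coprime_dvdl aA _; apply: coprime_dvdr bB _.
exact: coprime_prime_range_next.
Qed.

(** * Comparison of the two mean values *)

Section Comparison.
Variables (R : realType) (w : nat -> R) (v : nat -> R[i]).
Hypotheses (w_ge0 : forall n, 0 <= w n) (w1 : w 1%N = 1)
  (wM : forall m n, coprime m n -> w (m * n)%N = w m * w n)
  (v1 : v 1%N = 1) (vM : forall m n, coprime m n -> v (m * n)%N = v m * v n)
  (v_le_w : forall n, cnorm (v n) <= w n).

Local Notation wsum M := (\sum_(d <- divisors M) w d).
Local Notation vsum M := (\sum_(d <- divisors M) v d).
Local Notation wmean N := (\sum_(1 <= n < N.+1) w n).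
Local Notation dist M := (\sum_(d <- divisors M) cnorm (v d - (w d)%:C)).

Lemma wsum_ge1 M : 1 <= wsum M.
Proof.
rewrite (bigD1_seq 1%N) ?divisors_uniq ?divisor1 //= w1 lerDl.
exact: sumr_ge0.
Qed.

Lemma dist_term_le n : cnorm (v n - (w n)%:C) <= 2 * w n.
Proof. by apply: le_trans (cnormB _ _ _) _; rewrite cnormR //; have := v_le_w n; lra. Qed.

(** [sum_smooth_rough_split] gives [H = VA * Sv - Ev] and [G = WA * S - E]. Substituting both leaves
    [VA * (Sv - S)], two errors of size at most [E] because [VA] is at most [WA] in modulus, and the
    deviation of [VB / WB] from [1]. *)
Lemma comparison_bound A B N : (0 < A)%N -> (0 < B)%N -> coprime A B ->
  (forall n, 0 < n <= N -> n %| A * B)%N ->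
  cnorm (\sum_(1 <= n < N.+1) v n - vsum A * vsum B / (wsum A * wsum B)%:C * (wmean N)%:C) <=
  cnorm (vsum A) * \sum_(b <- divisors B | (b <= N)%N) cnorm (v b - (w b)%:C) +
  2 * \sum_(b <- divisors B | (b <= N)%N) \sum_(a <- divisors A | (N < a * b)%N) w a * w b +
  cnorm (vsum A) / wsum A * (dist B / wsum B) * wmean N.
Proof.
move=> A0 B0 coAB dvd; set G := wmean N.
have := sum_smooth_rough_split R w A B N wM A0 B0 coAB dvd.
have := sum_smooth_rough_split R[i] v A B N vM A0 B0 coAB dvd.
rewrite -/G; set Ev := \sum_(b <- _ | _) \sum_(a <- _ | _) _.
set E := \sum_(b <- _ | _) \sum_(a <- _ | _) _.
set Sv := \sum_(b <- divisors B | (b <= N)%N) v b.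
set S := \sum_(b <- divisors B | (b <= N)%N) w b.
set D := \sum_(b <- _ | (b <= N)%N) _.
have EvE : cnorm Ev <= E.
  apply: le_trans (cnorm_sum _ _ _ _ _) _; apply: ler_sum => b _.
  apply: le_trans (cnorm_sum _ _ _ _ _) _; apply: ler_sum => a _.
  by rewrite ComplexField.Normc.normcM ler_pM ?cnorm_ge0.
have SD : cnorm (Sv - S%:C) <= D.
  have -> : Sv - S%:C = \sum_(b <- divisors B | (b <= N)%N) (v b - (w b)%:C).
    by rewrite sumrB /S rmorph_sum.
  exact: cnorm_sum.
have BD : cnorm (vsum B - (wsum B)%:C) <= dist B.
  have -> : vsum B - (wsum B)%:C = \sum_(b <- divisors B) (v b - (w b)%:C).
    by rewrite sumrB rmorph_sum.
  exact: cnorm_sum.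
have VW : cnorm (vsum A) <= wsum A.
  by apply: le_trans (cnorm_sum _ _ _ _ _) _; apply: ler_sum.
have E0 : 0 <= E by apply: sumr_ge0 => b _; apply: sumr_ge0 => a _; rewrite mulr_ge0.
have G0 : 0 <= G by apply: sumr_ge0.
have WA1 := wsum_ge1 A; have WB1 := wsum_ge1 B.
move: (vsum A) (vsum B) (wsum A) (wsum B) (dist B) (\sum_(1 <= n < N.+1) v n) G
  BD VW WA1 WB1 G0 => VA VB WA WB DB H G BD VW WA1 WB1 G0 eH eG.
have WA0 : WA != 0 by rewrite gt_eqF // (lt_le_trans ltr01).
have WB0 : WB != 0 by rewrite gt_eqF // (lt_le_trans ltr01).
have WA0C : WA%:C != 0 by rewrite fmorph_eq0.
have WB0C : WB%:C != 0 by rewrite fmorph_eq0.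
have -> : H - VA * VB / (WA * WB)%:C * G%:C =
    VA * (Sv - S%:C) - Ev + VA / WA%:C * E%:C - VA / WA%:C * ((VB - WB%:C) / WB%:C) * G%:C.
  have -> : H = VA * Sv - Ev by rewrite eH addrK.
  have -> : G%:C = WA%:C * S%:C - E%:C by rewrite -rmorphM -rmorphB /= eG addrK.
  by rewrite rmorphM /=; field; rewrite WA0C WB0C.
have rho1 : cnorm (VA / WA%:C) <= 1.
  by rewrite ComplexField.Normc.normcM ComplexField.Normc.normcV cnormR ?(le_trans ler01) //
    ler_pdivrMr ?mul1r // (lt_le_trans ltr01).
apply: le_trans (cnormB _ _ _) _; apply: lerD; last first.
  rewrite !ComplexField.Normc.normcM !ComplexField.Normc.normcV !cnormR // ?(le_trans ler01) //.
  rewrite ler_wpM2r // ler_wpM2l //.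
    by rewrite divr_ge0 ?cnorm_ge0 // (le_trans ler01).
  by rewrite ler_wpM2r // invr_ge0 (le_trans ler01).
apply: le_trans (cnormD _ _ _) _.
have : cnorm (VA / WA%:C * E%:C) <= E.
  rewrite ComplexField.Normc.normcM (cnormR _ E) //.
  by rewrite -[leRHS]mul1r ler_wpM2r.
have : cnorm (VA * (Sv - S%:C) - Ev) <= cnorm VA * D + E.
  apply: le_trans (cnormB _ _ _) _; apply: lerD => //.
  by rewrite ComplexField.Normc.normcM ler_wpM2l ?cnorm_ge0.
lra.
Qed.

(** For divergent [t]: the ratio over the smooth part is small, so the trivial bound [2 * w]
    suffices for distances on the rough part. The constant is [10 = 2 * 4 + 2]. *)
Lemma comparison_of_small_ratio A B N (r eta : R) :
  (0 < A)%N -> (0 < B)%N -> coprime A B -> (forall n, 0 < n <= N -> n %| A * B)%N ->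
  wsum A * (\sum_(b <- divisors B | (b <= N)%N) w b) <= 4 * wmean N ->
  \sum_(b <- divisors B | (b <= N)%N) \sum_(a <- divisors A | (N < a * b)%N) w a * w b
    <= eta * wmean N ->
  0 <= r -> cnorm (vsum A) <= r * wsum A ->
  cnorm (\sum_(1 <= n < N.+1) v n - vsum A * vsum B / (wsum A * wsum B)%:C * (wmean N)%:C) <=
  (10 * r + 2 * eta) * wmean N.
Proof.
move=> A0 B0 coAB dvd; set G := wmean N => WAS Eeta r0 VAr.
apply: le_trans (comparison_bound A B N A0 B0 coAB dvd) _; rewrite -/G.
have G0 : 0 <= G by apply: sumr_ge0.
have WA1 := wsum_ge1 A; have WB1 := wsum_ge1 B.
have DB : dist B / wsum B <= 2.
  rewrite ler_pdivrMr ?(lt_le_trans ltr01) // mulr_sumr.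
  by apply: ler_sum => b _; apply: dist_term_le.
have DB0 : 0 <= dist B / wsum B.
  by rewrite divr_ge0 // ?sumr_ge0 // => *; rewrite cnorm_ge0.
have Vr : cnorm (vsum A) / wsum A <= r by rewrite ler_pdivrMr // (lt_le_trans ltr01).
have Vr0 : 0 <= cnorm (vsum A) / wsum A by rewrite divr_ge0 ?cnorm_ge0 // (le_trans ler01).
have t3 : cnorm (vsum A) / wsum A * (dist B / wsum B) * G <= r * 2 * G.
  by rewrite ler_wpM2r // ler_pM.
have t1 : cnorm (vsum A) * \sum_(b <- divisors B | (b <= N)%N) cnorm (v b - (w b)%:C) <=
    r * wsum A * (2 * \sum_(b <- divisors B | (b <= N)%N) w b).
  rewrite ler_pM ?cnorm_ge0 ?sumr_ge0 //; first by move=> *; apply: cnorm_ge0.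
  by rewrite mulr_sumr; apply: ler_sum => b _; apply: dist_term_le.
have t1' : r * (wsum A * \sum_(b <- divisors B | (b <= N)%N) w b) <= r * (4 * G).
  by rewrite ler_wpM2l.
move: t1 t1' t3 Eeta; clear; lra.
Qed.

(** For convergent [t]: the rough parts are close. The term [b = 1] is present in the rough sum,
    hence [wsum A <= 4 * wmean N], and the constant is [5 = 4 + 1]. *)
Lemma comparison_of_small_dist A B N (d eta : R) :
  (0 < A)%N -> (0 < B)%N -> coprime A B -> (forall n, 0 < n <= N -> n %| A * B)%N ->
  (0 < N)%N ->
  wsum A * (\sum_(b <- divisors B | (b <= N)%N) w b) <= 4 * wmean N ->
  \sum_(b <- divisors B | (b <= N)%N) \sum_(a <- divisors A | (N < a * b)%N) w a * w b
    <= eta * wmean N ->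
  dist B <= d ->
  cnorm (\sum_(1 <= n < N.+1) v n - vsum A * vsum B / (wsum A * wsum B)%:C * (wmean N)%:C) <=
  (5 * d + 2 * eta) * wmean N.
Proof.
move=> A0 B0 coAB dvd; set G := wmean N => N0 WAS Eeta distd.
apply: le_trans (comparison_bound A B N A0 B0 coAB dvd) _; rewrite -/G.
have G0 : 0 <= G by apply: sumr_ge0.
have WA1 := wsum_ge1 A; have WB1 := wsum_ge1 B.
have dist0 : 0 <= dist B by rewrite sumr_ge0 // => *; rewrite cnorm_ge0.
have VW : cnorm (vsum A) <= wsum A.
  by apply: le_trans (cnorm_sum _ _ _ _ _) _; apply: ler_sum.
have WA4 : wsum A <= 4 * G.
  apply: le_trans WAS; rewrite ler_peMr ?(le_trans ler01) //.
  rewrite big_mkcond (bigD1_seq 1%N) ?divisors_uniq ?divisor1 //= N0 w1 lerDl.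
  by apply: sumr_ge0 => b _; case: ifP.
have t3 : cnorm (vsum A) / wsum A * (dist B / wsum B) * G <= 1 * d * G.
  rewrite ler_wpM2r // ler_pM //.
  - by rewrite divr_ge0 ?cnorm_ge0 // (le_trans ler01).
  - by rewrite divr_ge0 // (le_trans ler01).
  - by rewrite ler_pdivrMr ?mul1r // (lt_le_trans ltr01).
  - rewrite ler_pdivrMr ?(lt_le_trans ltr01) //; apply: (le_trans distd).
    by rewrite ler_peMr // (le_trans dist0 distd).
have t1 : cnorm (vsum A) * \sum_(b <- divisors B | (b <= N)%N) cnorm (v b - (w b)%:C) <=
    4 * G * d.
  rewrite ler_pM ?cnorm_ge0 ?(le_trans VW) //.
    by apply: sumr_ge0 => *; apply: cnorm_ge0.
  apply: le_trans distd; rewrite big_mkcond; apply: ler_sum => b _.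
  by case: ifP => // _; exact: cnorm_ge0.
move: t1 t3 Eeta; clear; lra.
Qed.

(** On adjoining a prime, [v a * v b - w a * w b = (v a - w a) * v b + w a * (v b - w b)]. Local
    sums of [w] are at least [1], so the missing ones may be multiplied in to complete [wsum]. *)
Lemma dist_prime_range m n K : dist (prime_range_prod m n K) <=
  wsum (prime_range_prod m n K) *
  \sum_(m <= p < n | prime p) \sum_(k < K.+1) cnorm (v (p ^ k)%N - (w (p ^ k)%N)%:C).
Proof.
have dist1 : dist 1%N = 0.
  by rewrite big_seq1 v1 w1 subrr ComplexField.Normc.normc0.
have [nm|mn] := leqP n m.
  by rewrite /prime_range_prod !big_geq // dist1 mulr0.
elim: n mn => // n IHn; rewrite ltnS => mn.
have {}IHn : dist (prime_range_prod m n K) <= wsum (prime_range_prod m n K) *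
    \sum_(m <= p < n | prime p) \sum_(k < K.+1) cnorm (v (p ^ k)%N - (w (p ^ k)%N)%:C).
  move: mn; rewrite leq_eqVlt => /orP[/eqP ->|//].
  by rewrite /prime_range_prod !big_geq // dist1 mulr0.
rewrite prime_range_prodS //.
rewrite [X in _ <= _ * X]big_mkcond big_nat_recr //= -big_mkcond /=.
case: ifP => pn; last by rewrite muln1 addr0.
have P0 := prime_range_prod_gt0 m n K; have co := coprime_prime_range_next m n K pn.
set P := prime_range_prod m n K in P0 co IHn *.
have nK : (0 < n ^ K)%N by rewrite expn_gt0 prime_gt0.
rewrite -(big_divisors_pfactor _ n K (fun q => cnorm (v q - (w q)%:C))) //.
have coab a b : a \in divisors P -> b \in divisors (n ^ K) -> coprime a b.
  rewrite -!dvdn_divisors // => aP bn.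
  by apply: coprime_dvdl aP _; apply: coprime_dvdr bn _.
rewrite !big_divisors_coprimeM //.
have -> : \sum_(a <- divisors P) \sum_(b <- divisors (n ^ K)) w (a * b)%N =
    wsum P * wsum (n ^ K).
  rewrite mulr_suml big_seq [RHS]big_seq; apply: eq_bigr => a aP.
  rewrite mulr_sumr big_seq [RHS]big_seq; apply: eq_bigr => b bn.
  by rewrite wM // coab.
have : \sum_(a <- divisors P) \sum_(b <- divisors (n ^ K)) cnorm (v (a * b)%N - (w (a * b)%N)%:C)
    <= dist P * wsum (n ^ K) + wsum P * dist (n ^ K).
  rewrite !mulr_suml -big_split /= big_seq [leRHS]big_seq; apply: ler_sum => a aP.
  rewrite !mulr_sumr -big_split /= big_seq [leRHS]big_seq; apply: ler_sum => b bn.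
  rewrite vM ?wM ?coab // rmorphM /=.
  have -> : v a * v b - (w a)%:C * (w b)%:C =
      (v a - (w a)%:C) * v b + (w a)%:C * (v b - (w b)%:C) by ring.
  apply: le_trans (cnormD _ _ _) _; rewrite !ComplexField.Normc.normcM (cnormR _ (w a)) //.
  by rewrite lerD2r ler_wpM2l ?cnorm_ge0.
have W1 := wsum_ge1 P; have Wn1 := wsum_ge1 (n ^ K).
have D0 : 0 <= dist (n ^ K) by rewrite sumr_ge0 // => *; rewrite cnorm_ge0.
have D1 : wsum P * dist (n ^ K) <= wsum P * dist (n ^ K) * wsum (n ^ K).
  by rewrite ler_peMr // mulr_ge0 // (le_trans ler01).
have D2 := ler_wpM2r (le_trans ler01 Wn1) IHn.
move: D1 D2 {IHn}; move: (wsum P) (wsum _) (dist (n ^ K)) (\sum_(m <= p < n | _) _) => *.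
lra.
Qed.

End Comparison.

(** * Bounds for local factors and for sums over ranges of primes *)

Section PrimeRangeBounds.
Variables (R : realType) (w : nat -> R) (v : nat -> R[i]) (C : R).
Hypotheses (w_ge0 : forall n, 0 <= w n) (w1 : w 1%N = 1)
  (wM : forall m n, coprime m n -> w (m * n)%N = w m * w n)
  (v1 : v 1%N = 1) (vM : forall m n, coprime m n -> v (m * n)%N = v m * v n)
  (v_le_w : forall n, cnorm (v n) <= w n)
  (C_gt0 : 0 < C)
  (sum_prime_powers : forall u n, (0 < u <= n)%N ->
    \sum_(u.+1 <= q < n.+1 | `[< prime_power q >]) w q * ln (q%:R : R)
      <= C * (1 + ln (n%:R : R) - ln (u%:R : R)))
  (higher_tail : forall e : R, 0 < e -> exists Y : nat, forall y N : nat, (Y <= y)%N ->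
    \sum_(y.+1 <= q < N | `[< higher_prime_power q >]) w q <= e).

Local Notation wsum M := (\sum_(d <- divisors M) w d).
Local Notation vsum M := (\sum_(d <- divisors M) v d).
Local Notation dist M := (\sum_(d <- divisors M) cnorm (v d - (w d)%:C)).

Lemma sum_higher_le m n K :
  \sum_(m <= p < n | prime p) \sum_(k < K) w (p ^ k.+2)%N <=
  \sum_(m <= q < (n ^ K.+2).+1 | `[< higher_prime_power q >]) w q.
Proof.
rewrite (eq_bigr (fun p => \sum_(0 <= k < K) w (p ^ k.+2)%N)); last first.
  by move=> p _; rewrite big_mkord.
rewrite big_mkcond (eq_bigr (fun p =>
  \sum_(0 <= k < K) if prime p then w (p ^ k.+2)%N else 0)); last first.
  by move=> p _; case: ifP => // _; rewrite big1.
rewrite -(big_allpairs_dep (h := fun p k : nat => (p, k)) (r1 := index_iota m n)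
  (r2 := fun=> index_iota 0 K) (F := fun x => if prime x.1 then w (x.1 ^ x.2.+2)%N else 0)).
rewrite -big_mkcond /=.
pose f (x : nat * nat) := (x.1 ^ x.2.+2)%N.
apply: (@ler_sum_inj R _ nat _ _ (fun x => prime x.1) _ f w) => //.
- by apply: allpairs_uniq; rewrite ?iota_uniq // => -[? ?] [? ?] _ _ [-> ->].
- move=> [p k] [q l]; rewrite !inE /= => /andP[_ pp] /andP[_ pq]; rewrite /f /= => e.
  have epq : p = q by rewrite -[LHS](pdiv_pfactor k.+1 pp) e pdiv_pfactor.
  by move: e; rewrite -epq => /(expnI (prime_gt1 pp)) [->].
- move=> _ /allpairsP[[p k] [/= + + ->]] /=; rewrite !mem_index_iota.
  move=> /andP[mp pn] /andP[_ kK] pp; split; last by apply/asboolP; exists p, k.+2.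
  have p0 := prime_gt0 pp.
  rewrite ltnS (leq_trans mp) /=; last by rewrite /f expnS leq_pmulr ?expn_gt0 ?p0.
  apply: (@leq_trans (n ^ k.+2)); first by rewrite leq_exp2r // ltnW.
  by rewrite leq_pexp2l ?(leq_trans _ pn) // !ltnS ltnW.
Qed.

Lemma higher_bounded : exists T : R, forall N,
  \sum_(0 <= q < N | `[< higher_prime_power q >]) w q <= T.
Proof.
have [Y YP] := higher_tail 1 ltr01.
exists (\sum_(0 <= q < Y.+1 | `[< higher_prime_power q >]) w q + 1) => N.
have [NY|YN] := leqP N Y.+1.
  rewrite (big_cat_nat (n := N) (m := 0) (p := Y.+1)) //= -addrA lerDl.
  by rewrite addr_ge0 // sumr_ge0.
by rewrite (big_cat_nat (n := Y.+1)) //= ?(ltnW YN) // lerD2l YP.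
Qed.

Lemma factorE (S : pzRingType) (f : nat -> S) p K : f 1%N = 1 ->
  \sum_(k < K.+2) f (p ^ k)%N = 1 + f p + \sum_(k < K) f (p ^ k.+2)%N.
Proof. by move=> f1; rewrite !big_ord_recl /= expn0 f1 expn1 addrA. Qed.

(** The window from [1] to [p] of [sum_prime_powers] gives [w p * ln p <= C * (1 + ln p)], and
    [ln p >= ln 2] then bounds [w p]; the higher powers of [p] are part of a bounded sum. *)
Lemma factor_bound : exists2 Gam : R, 0 < Gam & forall p K, prime p ->
  \sum_(k < K.+2) w (p ^ k)%N <= Gam.
Proof.
have [T TP] := higher_bounded.
have T0 : 0 <= T by apply: le_trans (TP 0%N); rewrite big_geq.
have ln2 : 0 < ln (2 : R) by rewrite ln_gt0 // ltr1n.
have inv2 : 0 < (ln (2 : R))^-1 by rewrite invr_gt0.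
have Ci : 0 < C / ln (2 : R) by rewrite mulr_gt0.
exists (1 + (C + C / ln (2 : R)) + T) => [|p K pp].
  by rewrite ltr_wpDr // addr_gt0 // addr_gt0.
rewrite factorE // lerD //; last first.
  apply: le_trans (TP (p.+1 ^ K.+2).+1).
  apply: le_trans (sum_higher_le 0 p.+1 K); rewrite [leRHS]big_mkcond big_nat_recr //= pp lerDr.
  by apply: sumr_ge0 => q _; case: ifP => // _; apply: sumr_ge0.
rewrite lerD2l.
have p1 := prime_gt1 pp; have p0 := prime_gt0 pp.
have lnp : ln (2 : R) <= ln (p%:R : R).
  by rewrite ler_ln ?posrE ?ltr0n // ler_nat.
have lnp0 : 0 < ln (p%:R : R) by lra.
have /sum_prime_powers : (0 < 1 <= p)%N by rewrite p0.
rewrite ln1 subr0 big_mkcond big_nat_recr //= asboolT; last exact: prime_power_prime.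
set X := \sum_(_ <= _ < _) _ => h.
have X0 : 0 <= X.
  by apply: sumr_ge0 => q _; case: ifP => // _; rewrite mulr_ge0 ?ln_nat_ge0.
rewrite -(ler_pM2r lnp0) mulrDl.
have : C <= C / ln 2 * ln p%:R by rewrite mulrAC -mulrA ler_peMr ?(ltW C_gt0) // ler_pdivlMr ?mul1r.
lra.
Qed.

Lemma Re_le_w p : 0 <= w p - complex.Re (v p).
Proof.
rewrite subr_ge0; apply: le_trans (v_le_w p); apply: le_trans (Re_le_cnorm _ _).
exact: ler_norm.
Qed.

(** Per prime, with [t = w p - Re (v p)]: [cnorm_add1_le] takes [t / (1 + w p)] off the local factor
    of [w], which is at least the proportion [c * t] of it, and [1 - c * t <= expR (- (c * t))]. *)
Lemma smooth_ratio_le : exists2 c : R, 0 < c & forall n K,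
  cnorm (vsum (prime_range_prod 0 n K.+1)) <=
  expR (- (c * \sum_(0 <= p < n | prime p) (w p - complex.Re (v p)))) *
  wsum (prime_range_prod 0 n K.+1).
Proof.
have [Gam Gam0 GamP] := factor_bound.
(* One [Gam] bounds [1 + w p], the other the whole local factor. *)
exists (Gam^-1 * Gam^-1) => [|n K]; first by rewrite mulr_gt0 ?invr_gt0.
rewrite !sum_prime_range_divisors //.
set c := Gam^-1 * Gam^-1.
have factor p : prime p -> cnorm (\sum_(k < K.+2) v (p ^ k)%N) <=
    expR (- (c * (w p - complex.Re (v p)))) * \sum_(k < K.+2) w (p ^ k)%N.
  move=> pp; have := GamP p K pp; rewrite !factorE //.
  set r := \sum_(k < K) w _; set t := w p - complex.Re (v p) => WG.
  have r0 : 0 <= r by apply: sumr_ge0.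
  have t0 : 0 <= t by apply: Re_le_w.
  have s0 := w_ge0 p.
  apply: (@le_trans _ _ (1 + w p - t / (1 + w p) + r)).
    apply: le_trans (cnormD _ _ _) _; apply: lerD; first exact: cnorm_add1_le.
    by apply: le_trans (cnorm_sum _ _ _ _ _) _; apply: ler_sum.
  apply: (@le_trans _ _ ((1 - c * t) * (1 + w p + r))); last first.
    by rewrite ler_wpM2r ?expR_ge1Dx //; lra.
  have s1 : 0 < 1 + w p by lra.
  have : c * t * (1 + w p + r) <= t / (1 + w p).
    rewrite [c * t]mulrC -mulrA ler_wpM2l //.
    apply: (@le_trans _ _ (Gam^-1)).
      by rewrite /c -mulrA ler_piMr ?invr_ge0 ?(ltW Gam0) // mulrC ler_pdivrMr // mul1r.
    by rewrite lef_pV2 ?posrE //; lra.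
  lra.
suff : cnorm (\prod_(0 <= p < n | prime p) \sum_(k < K.+2) v (p ^ k)%N) <=
    expR (- (c * \sum_(0 <= p < n | prime p) (w p - complex.Re (v p)))) *
    (\prod_(0 <= p < n | prime p) \sum_(k < K.+2) w (p ^ k)%N) /\
    0 <= \prod_(0 <= p < n | prime p) \sum_(k < K.+2) w (p ^ k)%N by case.
elim/big_rec3: _ => [|p W t V pp [IH W0]].
  by rewrite ComplexField.Normc.normc1 mulr0 oppr0 expR0 mulr1.
split; last by rewrite mulr_ge0 // sumr_ge0.
rewrite ComplexField.Normc.normcM mulrDr opprD expRD mulrACA.
by rewrite ler_pM ?cnorm_ge0 ?factor.
Qed.

(** [dist_prime_range] reduces the claim to local distances: primes are handled by
    [cnorm_sub_real_le], higher powers by the trivial [2 * w]. The factor [wsum] is bounded through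
    [1 + x <= expR x]. *)
Lemma rough_dist_le y N K (s t r l : R) : 0 < l ->
  \sum_(y.+1 <= p < N.+1 | prime p) w p <= s ->
  \sum_(y.+1 <= p < N.+1 | prime p) (w p - complex.Re (v p)) <= t ->
  (forall n, \sum_(y.+1 <= q < n | `[< higher_prime_power q >]) w q <= r) ->
  dist (prime_range_prod y.+1 N.+1 K.+1) <= expR (s + r) * (l * s + t / l + 2 * r).
Proof.
move=> l0 hs ht hr.
have hr' : \sum_(y.+1 <= p < N.+1 | prime p) \sum_(k < K) w (p ^ k.+2)%N <= r.
  exact: le_trans (sum_higher_le _ _ _) (hr _).
apply: le_trans (dist_prime_range _ _ _ w_ge0 w1 wM v1 vM v_le_w _ _ _) _.
apply: ler_pM.
- by apply: sumr_ge0.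
- by apply: sumr_ge0 => p _; apply: sumr_ge0 => k _; apply: cnorm_ge0.
- rewrite sum_prime_range_divisors //.
  apply: (@le_trans _ _ (expR (\sum_(y.+1 <= p < N.+1 | prime p)
     (w p + \sum_(k < K) w (p ^ k.+2)%N)))); last first.
    by rewrite ler_expR big_split /= lerD.
  suff : 0 <= \prod_(y.+1 <= p < N.+1 | prime p) \sum_(k < K.+2) w (p ^ k)%N <=
    expR (\sum_(y.+1 <= p < N.+1 | prime p)
     (w p + \sum_(k < K) w (p ^ k.+2)%N)) by case/andP.
  elim/big_rec2: _ => [|p x z pp /andP[z0 zx]]; first by rewrite expR0 ler01 lexx.
  have f0 : 0 <= \sum_(k < K.+2) w (p ^ k)%N by apply: sumr_ge0.
  rewrite mulr_ge0 //= expRD ler_pM // factorE // -addrA; exact: expR_ge1Dx.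
- apply: (@le_trans _ _ (\sum_(y.+1 <= p < N.+1 | prime p) (l * w p +
    (w p - complex.Re (v p)) / l + 2 * \sum_(k < K) w (p ^ k.+2)%N))).
    apply: ler_sum => p pp; rewrite !big_ord_recl /= expn0 v1 w1 subrr.
    rewrite ComplexField.Normc.normc0 add0r expn1; apply: lerD.
      exact: cnorm_sub_real_le.
    rewrite mulr_sumr; apply: ler_sum => k _.
    exact: (dist_term_le _ _ _ w_ge0 v_le_w).
  rewrite !big_split /= -!mulr_sumr -mulr_suml.
  rewrite !lerD // ?ler_pM2l // ler_pM2r ?invr_gt0 //.
Qed.

(** From [N < (y + 1) ^ m <= y ^ (2 * m)], [ln N] is at most [2 * m * ln y], while each prime of the
    range is weighted by [ln p >= ln y] in [sum_prime_powers]. *)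
Lemma sum_prime_range_le y N m : (1 < y)%N -> 1 <= ln (y%:R : R) -> (y <= N)%N ->
  (N < y.+1 ^ m)%N ->
  \sum_(y.+1 <= p < N.+1 | prime p) w p <= C * (1 + 2 * m%:R).
Proof.
move=> y1 L1 yN Nym; have y0 : (0 < y)%N by apply: ltnW.
have N0 : (0 < N)%N by apply: leq_trans yN.
set L := ln (y%:R : R) in L1 *; have L0 : 0 < L by lra.
have yNb : (0 < y <= N)%N by rewrite y0.
have lnN : ln (N%:R : R) <= 2 * m%:R * L.
  have -> : 2 * m%:R * L = ln (((y ^ 2) ^ m)%N%:R : R).
    by rewrite ln_natX ?expn_gt0 ?y0 // ln_natX // -/L; ring.
  rewrite ler_ln ?posrE ?ltr0n ?expn_gt0 ?y0 // ler_nat ltnW // (leq_trans Nym) //.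
  case: (m) => // k; rewrite leq_exp2r //.
  apply: (@leq_trans (2 * y)); first by rewrite mul2n -addnn -addn1 leq_add2l.
  by rewrite expnS expn1 leq_mul2r y1 orbT.
rewrite -(ler_pM2l L0).
apply: (@le_trans _ _ (\sum_(y.+1 <= q < N.+1 | `[< prime_power q >]) w q * ln (q%:R : R))).
  rewrite mulr_sumr; apply: (@le_trans _ _ (\sum_(y.+1 <= p < N.+1 | prime p) w p * ln (p%:R : R))).
    rewrite big_nat_cond [leRHS]big_nat_cond; apply: ler_sum => p /andP[/andP[yp _] pp].
    by rewrite mulrC ler_wpM2l // ler_ln ?posrE ?ltr0n // ?prime_gt0 // ler_nat ltnW.
  apply: (@ler_sum_inj R nat nat _ _ _ _ id (fun q => w q * ln (q%:R : R))) => //.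
  - exact: iota_uniq.
  - by move=> p pr pp; split=> //; apply/asboolP; exact: prime_power_prime.
  - by move=> p _ _; rewrite mulr_ge0 // ln_nat_ge0.
apply: le_trans (sum_prime_powers _ _ yNb) _.
rewrite mulrCA ler_pM2l // -/L; lra.
Qed.

End PrimeRangeBounds.

(** * The estimate with truncated Euler products *)

Lemma tail_of_bounded_sums (R : realType) (a : nat -> R) (M : R) :
  (forall n, 0 <= a n) -> (forall n, \sum_(0 <= i < n) a i <= M) ->
  forall e : R, 0 < e -> exists Y : nat, forall y N : nat, (Y <= y)%N ->
    \sum_(y.+1 <= i < N) a i <= e.
Proof.
move=> a0 aM e e0; pose s n := \sum_(0 <= i < n) a i.
have s_homo m n : (m <= n)%N -> s m <= s n.
  by move=> mn; rewrite /s (big_cat_nat (n := m) (p := n)) //= lerDl sumr_ge0.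
have hs : has_sup (range s).
  by split; [exists (s 0%N), 0%N | exists M => _ [n _ <-]; exact: aM].
have [_ [Y _ <-] Ys] := sup_adherent e0 hs.
exists Y => y N Yy; have [Ny|yN] := leqP N y.+1; first by rewrite big_geq // ltW.
have sN : s N = s y.+1 + \sum_(y.+1 <= i < N) a i.
  by rewrite /s (big_cat_nat (n := y.+1)) //= ltnW.
have : s N <= sup (range s) by apply: ub_le_sup; [exact: hs.2 | exists N].
have := s_homo _ _ (leqW Yy); lra.
Qed.

(** Supplies the cut [y], the integer part of the root of [N] of order [m + 1]. *)
Lemma exists_nat_root m N : exists y, (y ^ m.+1 <= N < y.+1 ^ m.+1)%N.
Proof.
have ex : exists y, (y ^ m.+1 <= N)%N by exists 0%N; rewrite exp0n.
have ub y : (y ^ m.+1 <= N)%N -> (y <= N)%N.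
  apply: leq_trans; case: y => // y; rewrite expnS leq_pmulr // expn_gt0 //.
case: (ex_maxnP ex ub) => y yN ymax; exists y; rewrite yN /= ltnNge.
by apply/negP => /ymax; rewrite ltnn.
Qed.

Section MainEstimate.
Variables (R : realType) (w : nat -> R) (v : nat -> R[i]) (C : R).
Hypotheses (w_ge0 : forall n, 0 <= w n) (w1 : w 1%N = 1)
  (wM : forall m n, coprime m n -> w (m * n)%N = w m * w n)
  (v1 : v 1%N = 1) (vM : forall m n, coprime m n -> v (m * n)%N = v m * v n)
  (v_le_w : forall n, cnorm (v n) <= w n)
  (C_gt0 : 0 < C)
  (sum_prime_powers : forall u n, (0 < u <= n)%N ->
    \sum_(u.+1 <= q < n.+1 | `[< prime_power q >]) w q * ln (q%:R : R)
      <= C * (1 + ln (n%:R : R) - ln (u%:R : R)))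
  (higher_tail : forall e : R, 0 < e -> exists Y : nat, forall y N : nat, (Y <= y)%N ->
    \sum_(y.+1 <= q < N | `[< higher_prime_power q >]) w q <= e).

Local Notation wsum M := (\sum_(d <- divisors M) w d).
Local Notation vsum M := (\sum_(d <- divisors M) v d).
Local Notation wmean N := (\sum_(1 <= n < N.+1) w n).

Let ratio_split y N K : (y <= N)%N ->
  vsum (prime_range_prod 0 N.+1 K) / (wsum (prime_range_prod 0 N.+1 K))%:C =
  vsum (prime_range_prod 0 y.+1 K) * vsum (prime_range_prod y.+1 N.+1 K) /
  (wsum (prime_range_prod 0 y.+1 K) * wsum (prime_range_prod y.+1 N.+1 K))%:C.
Proof.
move=> yN; rewrite !sum_prime_range_divisors //.
by rewrite -!(big_cat_nat (n := y.+1) (m := 0) (p := N.+1)).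
Qed.

Let distance y := w y - complex.Re (v y).

Lemma truncated_estimate (eta : R) : 0 < eta -> exists N0 : nat, forall N K : nat,
  (N0 <= N)%N -> (N <= K)%N ->
  cnorm (\sum_(1 <= n < N.+1) v n -
    vsum (prime_range_prod 0 N.+1 K.+1) / (wsum (prime_range_prod 0 N.+1 K.+1))%:C
    * (wmean N)%:C) <= eta * wmean N.
Proof.
move=> eta0.
(* The smooth-rough error enters the comparison lemmas twice and costs [eta / 2]; the other half is
   spent as [5 * (eta / 10)] or [10 * (eta / 20)]. *)
have eta4 : 0 < eta / 4 by lra.
have [m [Y1 Y1P]] :=
  smooth_rough_estimates _ _ _ w_ge0 wM C_gt0 sum_prime_powers higher_tail _ eta4.
(* The exponent [m + 1] is positive, which ensures [y <= N], and it still implies [y ^ m <= N]. *)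
suff [Y2 Y2P] : exists Y2 : nat, forall y N K : nat, (Y2 <= y)%N ->
    (y ^ m.+1 <= N < y.+1 ^ m.+1)%N -> (N <= K)%N ->
    let A := prime_range_prod 0 y.+1 K.+1 in let B := prime_range_prod y.+1 N.+1 K.+1 in
    (0 < y)%N ->
    wsum A * (\sum_(b <- divisors B | (b <= N)%N) w b) <= 4 * wmean N ->
    \sum_(b <- divisors B | (b <= N)%N) \sum_(a <- divisors A | (N < a * b)%N) w a * w b
      <= eta / 4 * wmean N ->
    cnorm (\sum_(1 <= n < N.+1) v n - vsum A * vsum B / (wsum A * wsum B)%:C * (wmean N)%:C)
      <= eta * wmean N.
  exists ((maxn Y1 (maxn Y2 1)) ^ m.+1)%N => N K N0N NK.
  have [y yP] := exists_nat_root m N; have [yN Ny] := andP yP.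
  have : (maxn Y1 (maxn Y2 1) <= y)%N.
    by rewrite -ltnS -(ltn_exp2r _ _ (ltn0Sn m)) (leq_ltn_trans N0N).
  rewrite !geq_max => /and3P[yY1 yY2 y0].
  have yleN : (y <= N)%N by apply: leq_trans yN; rewrite expnS leq_pmulr // expn_gt0 y0.
  rewrite (ratio_split y) //.
  have ymN : (y ^ m <= N)%N by apply: leq_trans yN; rewrite leq_pexp2l.
  have [] := Y1P y N (prime_range_prod 0 y.+1 K.+1) (prime_range_prod y.+1 N.+1 K.+1) yY1 ymN
    (prime_range_prod_gt0 _ _ _) (prime_range_prod_gt0 _ _ _) (coprime_prime_ranges _ _ _ _).
    by move=> p pp /(prime_dvd_range _ _ _ _ pp).
  by move=> h1 h2; apply: (Y2P y N K).
have dvd y N K : (y <= N)%N -> (N <= K)%N -> forall n, (0 < n <= N)%N ->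
    (n %| prime_range_prod 0 y.+1 K.+1 * prime_range_prod y.+1 N.+1 K.+1)%N.
  move=> yN NK n nN; rewrite prime_range_prod_cat; first by rewrite dvd_prime_range_prod // leqW.
  by rewrite ltnS.
have y_le_N y N : (0 < y)%N -> (y ^ m.+1 <= N)%N -> (y <= N)%N.
  by move=> y0; apply: leq_trans; rewrite expnS leq_pmulr // expn_gt0 y0.
have dist0 p : 0 <= if prime p then distance p else 0.
  by case: ifP => // _; exact: (Re_le_w _ _ _ v_le_w).
(* The dichotomy on the convergence of the sum of [w p - Re (v p)] over primes. *)
have [[M MP]|unbounded] := pselect (exists M : R, forall n,
    \sum_(0 <= p < n) (if prime p then distance p else 0) <= M).
  have S0 : 0 < C * (1 + 2 * m.+1%:R) by rewrite mulr_gt0 // ltr_pwDl // mulr_ge0.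
  set S := C * (1 + 2 * m.+1%:R) in S0.
  pose eX := expR (S + 1); have eX0 : 0 < eX by exact: expR_gt0.
  (* These choices make [l * S = q], [q * l / l = q] and twice the higher tail at most [q]. The
     total is below [4 * q], and [eX * (4 * q) = eta / 10]. *)
  pose q := eta / (40 * eX); have q0 : 0 < q by rewrite divr_gt0 // mulr_gt0.
  pose l := q / S; have l0 : 0 < l by rewrite divr_gt0.
  have ql0 : 0 < q * l by rewrite mulr_gt0.
  have min0 : 0 < Num.min 1 (q / 2) by rewrite lt_min ltr01 divr_gt0.
  have [Y2 Y2P] := tail_of_bounded_sums _ _ _ dist0 MP _ ql0.
  have [Y3 Y3P] := higher_tail _ min0.
  have [Y4 Y4P] := ln_ge_near R 1.
  exists (maxn (maxn Y2 Y3) (maxn Y4 2)) => y N K.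
  rewrite !geq_max => /andP[/andP[y2 y3] /andP[y4 y1]] /andP[yN Ny] NK A B y0 h1 h2.
  have yleN := y_le_N _ _ y0 yN.
  have hs : \sum_(y.+1 <= p < N.+1 | prime p) w p <= S.
    by apply: (sum_prime_range_le _ _ _ w_ge0 C_gt0 sum_prime_powers) => //; apply: Y4P.
  have ht : \sum_(y.+1 <= p < N.+1 | prime p) (w p - complex.Re (v p)) <= q * l.
    by rewrite big_mkcond; apply: Y2P.
  have hd : \sum_(d <- divisors B) cnorm (v d - (w d)%:C) <= eta / 10.
    apply: le_trans (rough_dist_le _ _ _ w_ge0 w1 wM v1 vM v_le_w _ _ K _ _ _ _ l0 hs ht
      (fun n => Y3P y n y3)) _.
    have r1 : Num.min 1 (q / 2) <= 1 by rewrite ge_min lexx.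
    have r2 : Num.min 1 (q / 2) <= q / 2 by rewrite ge_min lexx orbT.
    apply: (@le_trans _ _ (eX * (4 * q))).
      apply: ler_pM; first exact: expR_ge0.
      - apply: ltW; apply: addr_gt0; last exact: mulr_gt0.
        by apply: addr_gt0; [exact: mulr_gt0 | exact: divr_gt0].
      - by rewrite ler_expR lerD2l.
      - rewrite mulfK ?gt_eqF // /l divfK ?gt_eqF //; lra.
    rewrite /q; have -> : eX * (4 * (eta / (40 * eX))) = eta / 10 by field; rewrite gt_eqF.
    by [].
  apply: le_trans (comparison_of_small_dist _ _ _ w_ge0 w1 wM vM v_le_w A B N _ _
    (prime_range_prod_gt0 _ _ _) (prime_range_prod_gt0 _ _ _) (coprime_prime_ranges _ _ _ _)
    (dvd y N K yleN NK) (leq_trans y0 yleN) h1 h2 hd) _.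
  by rewrite ler_wpM2r ?sumr_ge0 //; lra.
have [c c0 cP] :=
  smooth_ratio_le _ _ _ _ w_ge0 w1 wM v1 vM v_le_w C_gt0 sum_prime_powers higher_tail.
(* Chosen so that [expR (- (c * M)) = eta / 20]. *)
pose M := - ln (eta / 20) / c.
have [Y2 Y2M] : exists n, M < \sum_(0 <= p < n) (if prime p then distance p else 0).
  apply: contrapT => h; apply: unbounded; exists M => n.
  by rewrite leNgt; apply/negP => Mn; apply: h; exists n.
exists Y2 => y N K Y2y /andP[yN Ny] NK A B y0 h1 h2.
have yleN := y_le_N _ _ y0 yN.
have hr : cnorm (vsum A) <= eta / 20 * wsum A.
  apply: le_trans (cP y.+1 K) _; rewrite ler_wpM2r ?sumr_ge0 //.
  have e20 : 0 < eta / 20 by lra.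
  rewrite -[leRHS]lnK ?posrE // ler_expR big_mkcond lerNl.
  rewrite [leRHS]mulrC -ler_pdivrMr // -/M.
  rewrite (big_cat_nat (n := Y2)) //=; last exact: leqW.
  by apply: le_trans (ltW Y2M) _; rewrite lerDl sumr_ge0.
have e0 : 0 <= eta / 20 by lra.
apply: le_trans (comparison_of_small_ratio _ _ _ w_ge0 w1 wM vM v_le_w A B N _ _
    (prime_range_prod_gt0 _ _ _) (prime_range_prod_gt0 _ _ _) (coprime_prime_ranges _ _ _ _)
    (dvd y N K yleN NK) h1 h2 e0 hr) _.
by rewrite ler_wpM2r ?sumr_ge0 //; lra.
Qed.

End MainEstimate.

(** * Limits of truncated Euler products *)

Lemma cvg_prod_ratio (K : numFieldType) (n : nat) (P : pred nat) (u v : nat -> nat -> K)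
    (lu lv : nat -> K) :
  (forall p, P p -> (u p k : K^o) @[k --> \oo] --> (lu p : K^o)) ->
  (forall p, P p -> (v p k : K^o) @[k --> \oo] --> (lv p : K^o)) ->
  (forall p, P p -> lv p != 0) ->
  (\prod_(p < n | P p) (u p k / v p k) : K^o) @[k --> \oo] -->
  (\prod_(p < n | P p) (lu p / lv p) : K^o).
Proof.
move=> hu hv lv0.
apply: (@cvg_big K^o 'I_n *%R 1 (fun p : 'I_n => P p) _ nat \oo (index_enum _)
  (fun p k => u p k / v p k) (fun p => lu p / lv p)).
  exact: mul_continuous.
move=> p Pp; apply: (@cvgM K); first exact: hu.
by apply: cvgV; [exact: lv0 | exact: hv].
Qed.

(* Free of topologies, because the ones that [R[i]] inherits through its various structures
   are not identified by unification. *)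
Lemma lim_prod_ratio (K : numFieldType) (n : nat) (P : pred nat) (u v : nat -> nat -> K)
    (lu lv : nat -> K) :
  (forall p, P p -> forall e, 0 < e -> exists k0, forall k, (k0 <= k)%N -> `|lu p - u p k| < e) ->
  (forall p, P p -> forall e, 0 < e -> exists k0, forall k, (k0 <= k)%N -> `|lv p - v p k| < e) ->
  (forall p, P p -> lv p != 0) ->
  forall e, 0 < e -> exists k0, forall k, (k0 <= k)%N ->
  `|\prod_(p < n | P p) (lu p / lv p) - \prod_(p < n | P p) (u p k / v p k)| < e.
Proof.
move=> hu hv lv0 e e0.
have cvgE (x : nat -> K) l : (forall e, 0 < e -> exists k0, forall k, (k0 <= k)%N ->
    `|l - x k| < e) -> (x k : K^o) @[k --> \oo] --> (l : K^o).
  move=> h; apply/cvgrPdist_lt => d d0; have [k0 k0P] := h d d0.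
  by exists k0.
have := cvg_prod_ratio K n P u v lu lv (fun p Pp => cvgE _ _ (hu p Pp))
  (fun p Pp => cvgE _ _ (hv p Pp)) lv0.
by move=> /cvgrPdist_lt /(_ e e0) [k0 _ k0P]; exists k0.
Qed.

Section ComplexLimits.
Variable R : realType.

(** A positive element of [R[i]] has zero imaginary part, so real radii suffice. *)
Lemma cvg_cnormP (T : Type) (F : set_system T) (FF : Filter F) (f : T -> (R[i])^o) (l : (R[i])^o) :
  (f x @[x --> F] --> l) <->
  (forall e : R, 0 < e -> \forall x \near F, cnorm (l - f x) < e).
Proof.
split=> [/cvgrPdist_lt h e e0|h].
  have e0C : 0 < e%:C by rewrite ltcR.
  by apply: filterS (h _ e0C) => x; rewrite -cnormE ltcR.
apply/cvgrPdist_lt => -[a b]; rewrite ltcE /= => /andP[/eqP -> a0].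
by apply: filterS (h _ a0) => x; rewrite -ltcR.
Qed.

Lemma cvg_complexP (u : nat -> R[i]) (l : R[i]) :
  ((u n : (R[i])^o) @[n --> \oo] --> (l : (R[i])^o)) <->
  (forall e : R[i], 0 < e -> exists k0, forall k, (k0 <= k)%N -> `|l - u k| < e).
Proof.
split=> [/cvg_cnormP h [a b]|h].
  rewrite ltcE /= => /andP[/eqP -> a0]; have [k0 _ k0P] := h a a0.
  by exists k0 => k kk0; rewrite -cnormE ltcR k0P.
apply/cvg_cnormP => e e0; have e0C : 0 < e%:C by rewrite ltcR.
have [k0 k0P] := h _ e0C; exists k0 => // k /= kk0.
by rewrite -ltcR cnormE k0P.
Qed.

Lemma bounded_sums_cvg (a : nat -> R) (M : R) :
  (forall n, \sum_(k < n) `|a k| <= M) -> cvgn (series a).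
Proof.
move=> aM; apply: normed_cvg; apply: nondecreasing_is_cvgn.
  by apply: nondecreasing_series => n _ _; exact: normr_ge0.
by exists M => _ [n _ <-]; rewrite -[leLHS]/(\sum_(0 <= k < n) `|a k|) big_mkord.
Qed.

(** The real and imaginary parts converge absolutely, both being dominated by the modulus. *)
Lemma complex_series_cvg (z : nat -> R[i]) (M : R) :
  (forall n, \sum_(k < n) cnorm (z k) <= M) ->
  cvgn (fun n => \sum_(k < n) z k : (R[i])^o).
Proof.
move=> zM.
have cRe : cvgn (series (fun k => complex.Re (z k))).
  apply: (bounded_sums_cvg _ M) => n; apply: le_trans (zM n).
  by apply: ler_sum => k _; exact: Re_le_cnorm.
have cIm : cvgn (series (fun k => complex.Im (z k))).
  apply: (bounded_sums_cvg _ M) => n; apply: le_trans (zM n).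
  by apply: ler_sum => k _; exact: Im_le_cnorm.
set a := limn (series (fun k => complex.Re (z k))) in cRe.
set b := limn (series (fun k => complex.Im (z k))) in cIm.
apply/cvg_ex; exists (a +i* b); apply/cvg_cnormP => e e0.
have e2 : 0 < e / 2 by rewrite divr_gt0.
move/cvgrPdist_lt: cRe => /(_ _ e2) nRe; move/cvgrPdist_lt: cIm => /(_ _ e2) nIm.
near=> n.
have -> : a +i* b - \sum_(k < n) z k =
    (a - series (fun k => complex.Re (z k)) n) +i* (b - series (fun k => complex.Im (z k)) n).
  have -> : \sum_(k < n) z k =
    (series (fun k => complex.Re (z k)) n) +i* (series (fun k => complex.Im (z k)) n).
    rewrite /series /= !big_mkord.
    by elim/big_rec3: _ => [//|k y x t _ ->]; case: (z k).
  by [].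
have hx : `|a - series (fun k => complex.Re (z k)) n| < e / 2 by near: n.
have hy : `|b - series (fun k => complex.Im (z k)) n| < e / 2 by near: n.
move: hx hy; set x := a - _; set y := b - _ => hx hy.
have -> : (x +i* y)%C = x%:C + (0 +i* y)%C.
  by rewrite /GRing.add /= addr0 add0r.
apply: le_lt_trans (cnormD _ _ _) _.
have -> : cnorm x%:C = `|x| by rewrite /ComplexField.Normc.normc /= expr0n addr0 sqrtr_sqr.
have -> : cnorm (0 +i* y)%C = `|y|.
  by rewrite /ComplexField.Normc.normc /= expr0n add0r sqrtr_sqr.
lra.
Unshelve. all: by end_near.
Qed.

Lemma cvg_neq0_of_ge1 (u : nat -> R[i]) (l : R[i]) :
  (u n : (R[i])^o) @[n --> \oo] --> (l : (R[i])^o) ->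
  (forall n, 1 <= cnorm (u n)) -> l != 0.
Proof.
move=> /cvg_cnormP ul u1; apply/eqP => l0.
have [n _ /(_ n (leqnn n))] := ul 1 ltr01.
by rewrite l0 sub0r cnormN ltNge u1.
Qed.

End ComplexLimits.

(** * Partial summation, passage to full Euler factors, and conclusion *)

(** Partial summation as an induction on [n]: the boundary term [S n / n] is carried along and
    replaced by [C] only at the end. *)
Lemma sum_div_le_ln (R : realType) (f : nat -> R) (C : R) :
  (forall n, 0 <= f n) -> 0 <= C -> (forall n, \sum_(1 <= q < n.+1) f q <= C * n%:R) ->
  forall u n, (0 < u <= n)%N ->
  \sum_(u.+1 <= q < n.+1) f q / q%:R <= C * (1 + ln (n%:R : R) - ln (u%:R : R)).
Proof.
move=> f0 C0 fC u n /andP[u0 un].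
pose S n := \sum_(1 <= q < n.+1) f q.
suff : \sum_(u.+1 <= q < n.+1) f q / q%:R <= S n / n%:R + C * (ln (n%:R : R) - ln (u%:R : R)).
  have : S n / n%:R <= C by rewrite ler_pdivrMr ?ltr0n ?(leq_trans u0) //; exact: fC.
  lra.
have S0 k : 0 <= S k by apply: sumr_ge0.
elim: n un => [|n IHn]; first by rewrite leqNgt u0.
rewrite leq_eqVlt => /orP[/eqP <-|].
  by rewrite big_geq // subrr mulr0 addr0 divr_ge0.
rewrite ltnS => un; have n0 : (0 < n)%N by apply: leq_trans un.
rewrite big_nat_recr //=.
have Sn : S n.+1 = S n + f n.+1 by rewrite /S big_nat_recr.
have {}IHn := IHn un.
have nR0 : 0 < n%:R :> R by rewrite ltr0n.
have n1R0 : 0 < n.+1%:R :> R by rewrite ltr0n.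
have step : S n / n%:R - S n / n.+1%:R <= C / n.+1%:R.
  have -> : S n / n%:R - S n / n.+1%:R = S n / n%:R / n.+1%:R.
    by rewrite -[n.+1%:R]natr1; field; rewrite natr1 !gt_eqF.
  by rewrite ler_pM2r ?invr_gt0 // ler_pdivrMr //; exact: fC.
(* This is [- ln (1 - x) >= x] at [x = 1 / (n + 1)]; it absorbs the loss [C / (n + 1)] from
   [step]. *)
have logstep : (n.+1%:R)^-1 <= ln (n.+1%:R : R) - ln (n%:R : R).
  have -> : ln (n.+1%:R : R) - ln (n%:R : R) = - ln (1 + - n.+1%:R^-1).
    have -> : 1 + - n.+1%:R^-1 = n%:R / n.+1%:R :> R.
      by rewrite -[n.+1%:R]natr1; field; rewrite natr1 gt_eqF.
    by rewrite ln_div ?posrE // opprB.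
  rewrite lerNr; apply: le_ln1Dx; rewrite ltrN2 invf_lt1 // ltr1n.
  by rewrite ltnS.
move: IHn step (ler_wpM2l C0 logstep); rewrite Sn mulrDl.
move: (\sum_(_ <= _ < _) _) (S n / n%:R) (S n / n.+1%:R) (f n.+1 / n.+1%:R) => a b c d.
rewrite !mulrBr; move: (C / _) (C * ln n.+1%:R) (C * ln n%:R) (C * ln u%:R) => *; lra.
Qed.

(** The bound [B] makes every local series converge absolutely, and the local factors of [w] are at
    least [1], so the denominators have nonzero limits. *)
Lemma euler_ratio_cvg (R : realType) (w : nat -> R) (v : nat -> R[i]) (B : R) (N : nat) :
  (forall n, 0 <= w n) -> w 1%N = 1 -> (forall n, cnorm (v n) <= w n) ->
  (forall p K, prime p -> \sum_(k < K.+2) w (p ^ k)%N <= B) ->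
  (\prod_(p < N | prime p)
    ((\sum_(k < K.+2) v (p ^ k)%N) / (\sum_(k < K.+2) w (p ^ k)%N)%:C) : (R[i])^o)
    @[K --> \oo] -->
  (\prod_(p < N | prime p)
    (limn (fun n => \sum_(k < n) v (p ^ k)%N : (R[i])^o) /
     limn (fun n => \sum_(k < n) (w (p ^ k)%N)%:C : (R[i])^o)) : (R[i])^o).
Proof.
move=> w0 w1 vw wB.
have wB' p n : prime p -> \sum_(k < n) w (p ^ k)%N <= B.
  move=> pp; apply: le_trans (wB p n pp); rewrite !big_ord_recr /= -addrA lerDl.
  by rewrite addr_ge0.
have cvgE (u : nat -> R[i]) p : prime p -> (forall n, cnorm (u n) <= w n) ->
    (\sum_(k < K.+2) u (p ^ k)%N : (R[i])^o) @[K --> \oo] -->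
    (limn (fun n => \sum_(k < n) u (p ^ k)%N : (R[i])^o) : (R[i])^o).
  move=> pp uw; have : cvgn (fun n => \sum_(k < n) u (p ^ k)%N : (R[i])^o).
    apply: (complex_series_cvg _ (fun k => u (p ^ k)%N) B) => n; apply: le_trans (wB' p n pp).
    by apply: ler_sum.
  move=> /cvg_cnormP cu; apply/cvg_cnormP => e e0.
  have [K0 _ K0P] := cu e e0; exists K0 => // K /= KK0; apply: K0P => /=.
  by rewrite (leq_trans KK0) // -addn2 leq_addr.
have ww n : cnorm (w n)%:C <= w n by rewrite cnormR.
have wcvg p : prime p -> ((\sum_(k < K.+2) w (p ^ k)%N)%:C : (R[i])^o) @[K --> \oo] -->
    (limn (fun n => \sum_(k < n) (w (p ^ k)%N)%:C : (R[i])^o) : (R[i])^o).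
  move=> pp; have := cvgE (fun n => (w n)%:C) p pp ww.
  apply: cvg_trans; apply: near_eq_cvg; near=> K.
  by rewrite rmorph_sum.
apply/cvg_complexP.
apply: (@lim_prod_ratio R[i] N prime (fun p K => \sum_(k < K.+2) v (p ^ k)%N)
  (fun p K => (\sum_(k < K.+2) w (p ^ k)%N)%:C)
  (fun p => limn (fun n => \sum_(k < n) v (p ^ k)%N : (R[i])^o))
  (fun p => limn (fun n => \sum_(k < n) (w (p ^ k)%N)%:C : (R[i])^o))) => p pp.
- exact/cvg_complexP/cvgE.
- exact/cvg_complexP/wcvg.
apply: cvg_neq0_of_ge1 (wcvg p pp) _ => K.
rewrite cnormR ?sumr_ge0 // big_ord_recl /= expn0 w1 lerDl.
exact: sumr_ge0.
Unshelve. all: by end_near.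
Qed.

Theorem theorem1 (R : realType) (g : nat -> R) (h : nat -> R[i])
  (g_ge0 : forall n : nat, 0 <= g n)
  (g_mult : arith_multiplicative g)
  (ha : exists beta : R, forall p : nat, prime p -> g p <= beta)
  (hb : cvgn (fun N : nat =>
          \sum_(q < N | `[< higher_prime_power q >]) g q / q%:R))
  (hc : exists C : R, forall y : R, 2 <= y ->
          y^-1 * sum_upto y (fun q => if `[< prime_power q >]
                                      then g q * ln (q%:R : R) else 0) <= C)
  (h_mult : arith_multiplicative h)
  (h_le_g : forall n : nat, (1 <= n)%N -> `|h n| <= (g n)%:C) :
  exists eps : R -> (R[i])^o,
    (eps x @[x --> +oo] --> (0 : (R[i])^o)) /\
    forall x : R, 1 <= x ->
      sum_upto x (fun n => h n / n%:R) =
      (\prod_(p < (Num.truncn x).+1 | prime p)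
          (euler_factor h p / euler_factor (fun n => (g n)%:C) p)
       + eps x) * (sum_upto x (fun n => g n / n%:R))%:C.
Proof.
pose w n : R := g n / n%:R; pose v n : R[i] := h n / n%:R.
have [g1 gM] := g_mult; have [h1 hM] := h_mult.
have w_ge0 n : 0 <= w n by rewrite divr_ge0.
have w1 : w 1%N = 1 by rewrite /w g1 divr1.
have v1 : v 1%N = 1 by rewrite /v h1 divr1.
have wM m n : coprime m n -> w (m * n)%N = w m * w n.
  by move=> co; rewrite /w gM // natrM invfM mulrACA.
have vM m n : coprime m n -> v (m * n)%N = v m * v n.
  by move=> co; rewrite /v hM // natrM invfM mulrACA.
have natC n : n%:R = (n%:R : R)%:C by rewrite rmorph_nat.
have v_le_w n : cnorm (v n) <= w n.
  (* The bound on [h] starts at [1]; at [0], division by zero makes both [v 0] and [w 0] vanish. *)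
  case: n => [|n]; first by rewrite /v /w !invr0 !mulr0 ComplexField.Normc.normc0.
  rewrite /v /w ComplexField.Normc.normcM ComplexField.Normc.normcV natC cnormR //.
  by rewrite ler_pM2r ?invr_gt0 // -lecR cnormE h_le_g.
have [C0 C0P] := hc.
pose C := Num.max C0 1.
have C_gt0 : 0 < C by rewrite lt_max ltr01 orbT.
have sum_prime_powers u n : (0 < u <= n)%N ->
    \sum_(u.+1 <= q < n.+1 | `[< prime_power q >]) w q * ln (q%:R : R)
      <= C * (1 + ln (n%:R : R) - ln (u%:R : R)).
  move=> un; pose f q : R := if `[< prime_power q >] then g q * ln (q%:R : R) else 0.
  have f0 q : 0 <= f q by rewrite /f; case: ifP => // _; rewrite mulr_ge0 ?ln_nat_ge0.
  apply: le_trans (sum_div_le_ln _ f C f0 (ltW C_gt0) _ u n un).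
    rewrite big_mkcond; apply: ler_sum => q _; rewrite /f; case: ifP => _; last by rewrite mul0r.
    by rewrite /w mulrAC.
  (* Condition (c) starts at [y = 2]; below that only [q = 1] can occur, with [ln 1 = 0]. *)
  move=> k; have [k1|k1] := leqP 2 k; last first.
    apply: (@le_trans _ _ 0); last by rewrite mulr_ge0 // ltW.
    rewrite big_nat big1 // => q; rewrite ltnS => /andP[q0 qk].
    have -> : q = 1%N by apply/eqP; rewrite eqn_leq q0 andbT (leq_trans qk).
    by rewrite /f ln1 mulr0; case: ifP.
  have k2 : 2 <= k%:R :> R by rewrite ler_nat.
  have := C0P _ k2; rewrite /sum_upto natrK mulrC ler_pdivrMr; last by rewrite ltr0n ltnW.
  by move=> /le_trans; apply; rewrite ler_wpM2r // le_max lexx.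
have higher_tail (e : R) : 0 < e -> exists Y : nat, forall y N : nat, (Y <= y)%N ->
    \sum_(y.+1 <= q < N | `[< higher_prime_power q >]) w q <= e.
  move=> e0; pose a q := if `[< higher_prime_power q >] then w q else 0.
  have a0 q : 0 <= a q by rewrite /a; case: ifP.
  pose s N := \sum_(q < N | `[< higher_prime_power q >]) g q / q%:R.
  have sE N : \sum_(0 <= q < N) a q = s N by rewrite big_mkord /s [RHS]big_mkcond.
  have s_homo : {homo s : m n / (m <= n)%N >-> m <= n}.
    move=> m n mn; rewrite -!sE (big_cat_nat (n := m) (p := n)) //= lerDl.
    exact: sumr_ge0.
  have sM N : \sum_(0 <= q < N) a q <= limn s.
    by rewrite sE; exact: nondecreasing_cvgn_le s_homo hb N.
  have [Y YP] := tail_of_bounded_sums _ _ _ a0 sM _ e0.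
  by exists Y => y N Yy; rewrite big_mkcond; exact: YP.
have [B _ BP] := factor_bound _ _ _ w_ge0 w1 C_gt0 sum_prime_powers higher_tail.
pose P N : R[i] := \prod_(p < N.+1 | prime p)
  (euler_factor h p / euler_factor (fun n => (g n)%:C) p).
have PE N : P N = \prod_(p < N.+1 | prime p)
    (limn (fun n => \sum_(k < n) v (p ^ k)%N : (R[i])^o) /
     limn (fun n => \sum_(k < n) (w (p ^ k)%N)%:C : (R[i])^o)).
  apply: eq_bigr => p pp; rewrite /euler_factor.
  have -> // : (fun n => \sum_(k < n) (g (p ^ k)%N)%:C / ((p ^ k)%N)%:R : (R[i])^o) =
      (fun n => \sum_(k < n) (w (p ^ k)%N)%:C : (R[i])^o).
  apply/funext => n; apply: eq_bigr => k _.
  by rewrite /w rmorphM /= fmorphV natC.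
pose G N := \sum_(1 <= n < N.+1) w n.
pose H N := \sum_(1 <= n < N.+1) v n.
have G_ge1 N : (0 < N)%N -> 1 <= G N.
  by move=> N0; rewrite /G big_ltn ?ltnS // w1 lerDl; exact: sumr_ge0.
have estimate (e : R) : 0 < e -> exists N0 : nat, forall N, (N0 <= N)%N ->
    cnorm (H N - P N * (G N)%:C) <= e * G N.
  move=> e0; have e2 : 0 < e / 2 by rewrite divr_gt0.
  have [N0 N0P] := truncated_estimate _ _ _ _ w_ge0 w1 wM v1 vM v_le_w C_gt0
    sum_prime_powers higher_tail _ e2.
  exists N0 => N N0N.
  have := euler_ratio_cvg _ _ _ _ N.+1 w_ge0 w1 v_le_w BP.
  rewrite -PE => /cvg_cnormP /(_ _ e2) [K0 _ K0P].
  (* With [N] fixed, the exponent is taken large enough for the truncated ratio [Q] to be within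
     [e / 2] of [P N], and at least [N] as [truncated_estimate] demands. *)
  have := K0P (maxn K0 N) (leq_maxl _ _).
  have := N0P N (maxn K0 N) N0N (leq_maxr _ _).
  rewrite !sum_prime_range_divisors // !big_mkord rmorph_prod /= -prodf_div.
  set Q := \prod_(p < N.+1 | prime p) _ => hQ PQ.
  have -> : H N - P N * (G N)%:C = (H N - Q * (G N)%:C) - (P N - Q) * (G N)%:C by ring.
  have G0 : 0 <= G N by apply: sumr_ge0.
  apply: le_trans (cnormB _ _ _) _.
  have : cnorm ((P N - Q) * (G N)%:C) <= e / 2 * G N.
    by rewrite ComplexField.Normc.normcM cnormR // ler_wpM2r // ltW.
  move: hQ; rewrite -/(G N) -/(H N); lra.
(* The error is found by solving the claimed identity for it; for [x >= 1] the divisor [G] is at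
   least [1]. *)
exists (fun x => H (Num.truncn x) / (G (Num.truncn x))%:C - P (Num.truncn x)); split.
  apply/cvg_cnormP => e e0; have e2 : 0 < e / 2 by rewrite divr_gt0.
  have [N0 N0P] := estimate _ e2.
  near=> x; rewrite sub0r cnormN.
  have xN : (maxn N0 1 <= Num.truncn x)%N.
    by rewrite truncn_ge_nat; near: x; apply: nbhs_pinfty_ge; rewrite num_real.
  set N := Num.truncn x in xN *.
  have [N0N N1] : (N0 <= N)%N /\ (0 < N)%N by move: xN; rewrite geq_max => /andP.
  have G1 := G_ge1 N N1; have G0 : 0 < G N by lra.
  have G0C : (G N)%:C != 0 by rewrite fmorph_eq0 gt_eqF.
  have -> : H N / (G N)%:C - P N = (H N - P N * (G N)%:C) / (G N)%:C by field.
  rewrite ComplexField.Normc.normcM ComplexField.Normc.normcV cnormR ?(ltW G0) //.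
  by apply: (@le_lt_trans _ _ (e / 2)); [rewrite ler_pdivrMr // N0P | lra].
move=> x x1; have N1 : (0 < Num.truncn x)%N by rewrite truncn_gt0.
rewrite /sum_upto -/(P _) -/(G _) -/(H _) addrCA subrr addr0 divfK //.
by rewrite fmorph_eq0 gt_eqF // (lt_le_trans ltr01) // G_ge1.
Unshelve. all: by end_near.
Qed.
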